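(* Let $d\ge1$, let $\lambda>0$, and let $P_\lambda$ be the Poisson point process in $\mathbb{R}^d$ with constant intensity $\lambda$. Then the image $\psi_{\mathscr{D}_V}(P_\lambda)$ of $P_\lambda$ under the mapping $$\psi_{\mathscr{D}_V}(\eta)=\sum_{X\in\mathfrak{X}_d,\ (X,\eta)\in\mathscr{D}_V}\delta_X$$ is a complete random cluster tessellation in $\mathbb{R}^d$, i.e. a random cluster tessellation that is almost surely complete.
   Context: Point processes. $\mathscr{M}^{\bullet}(\mathbb{R}^d)$ is the set of locally finite simple counting measures on $\mathbb{R}^d$, identified with locally finite subsets $\eta\subset\mathbb{R}^d$, with the $\sigma$-algebra generated by the counting functions $\eta\mapsto\eta(B)$, $B$ bounded Borel. $P_\lambda$ is the Poisson point process on $\mathbb{R}^d$ with intensity measure $\lambda$ times Lebesgue measure. Clusters. $\mathfrak{X}_d=\{X\subset\mathbb{R}^d:\operatorname{card}(X)<\infty\}$ is the space of clusters, with the $\sigma$-algebra generated, analogously, by the counting functions $X\mapsto\operatorname{card}(X\cap B)$. $\mathscr{M}^{\bullet}(\mathfrak{X}_d)$ is the set of locally finite cluster configurations, i.e. sets of clusters (written as sums of Dirac measures $\delta_X$) such that only finitely many of the clusters meet any given bounded subset of $\mathbb{R}^d$; its $\sigma$-algebra is generated by the counting functions. A probability measure on it is a cluster process. Tessellations. $\langle X\rangle$ is the convex hull of $X$. A cluster $X$ is a discrete polytope if for every $a\in X$ there is a supporting hyperplane $H$ of $\langle X\rangle$ with $H\cap\langle X\rangle=\{a\}$ (equivalently,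 $X$ is the vertex set of the convex polytope $\langle X\rangle$). A collection $\mu\in\mathscr{M}^{\bullet}(\mathfrak{X}_d)$ of discrete polytopes is a cluster tessellation if the convex hulls of its clusters form a locally finite face-to-face tiling, where face-to-face means only that whenever two tiles intersect, they intersect in whole faces (a common face of both); holes are allowed in general. It is complete if the convex hulls of its clusters cover $\mathbb{R}^d$. A random cluster tessellation is a cluster process concentrated on the set of cluster tessellations. The property $\mathscr{D}_V$. For $\eta\in\mathscr{M}^{\bullet}(\mathbb{R}^d)$ and $a\in\eta$, the Voronoi cell is $V_\eta(a)=\{v\in\mathbb{R}^d : \text{no other point of }\eta\text{ is closer to }v\text{ than }a\}$. A pair $(X,\eta)\in\mathfrak{X}_d\times\mathscr{M}^{\bullet}(\mathbb{R}^d)$ belongs to $\mathscr{D}_V$ if: (i) the convex hull of $\eta$ is $\mathbb{R}^d$; and (ii) $X$ is the vertex set of a Voronoi cell $V_\eta(a)$ for some $a\in\eta$ (which under (i) is a convex polytope). *)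

(* Defs.v *)
From HB Require Import structures.
From mathcomp Require Import all_boot all_order all_algebra finmap.
From mathcomp Require Import all_classical all_reals all_analysis.

Set Implicit Arguments.
Unset Strict Implicit.
Unset Printing Implicit Defensive.

Import Order.TTheory GRing.Theory Num.Theory.
Import numFieldNormedType.Exports.

Local Open Scope classical_set_scope.
Local Open Scope card_scope.
Local Open Scope ring_scope.

(* The library norm on 'rV[R]_d is the sup norm. It is used below only for the
   topology and for boundedness; Voronoi cells need the Euclidean distance. *)
Definition dotp (R : realType) (d : nat) (u v : 'rV[R]_d) : R :=
  \sum_(i < d) u 0 i * v 0 i.

Definition edist (R : realType) (d : nat) (u v : 'rV[R]_d) : R :=
  Num.sqrt (dotp (u - v) (u - v)).

Definition bounded_borel (R : realType) (d : nat) : set (set 'rV[R]_d) :=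
  [set B | bounded_set B /\ <<s @open 'rV[R]_d >> B].

(* d-dimensional Lebesgue measure, as the product of the one-dimensional
   Lebesgue measure with the (d-1)-dimensional one. *)
Fixpoint volume (R : realType) (d : nat) : set 'rV[R]_d -> \bar R :=
  match d return set 'rV[R]_d -> \bar R with
  | 0 => fun A => (\1_A 0)%:E
  | d'.+1 => fun A =>
      (\int[@lebesgue_measure R]_x
         volume [set v : 'rV[R]_d' | A (row_mx (x%:M : 'rV[R]_1) v)])%E
  end.

(* Generators of the sigma-algebra making the maps u |-> card (pts u `&` B),
   for B in C, measurable. These maps take their values in nat plus infinity,
   so the level sets at finite k suffice. *)
Definition counting_events (T U : Type) (pts : U -> set T) (C : set (set T)) :
    set (set U) :=
  [set E | exists2 B, C B & exists k : nat, E = [set u | pts u `&` B #= `I_k]].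

Definition locally_finite (R : realType) (d : nat) (eta : set 'rV[R]_d) :=
  forall B : set 'rV[R]_d, bounded_set B -> finite_set (eta `&` B).

Record point_set (R : realType) (d : nat) := PointSet {
  points :> set 'rV[R]_d;
  points_lfin : locally_finite points }.

Section point_set_instances.
Context (R : realType) (d : nat).

Lemma locally_finite0 : locally_finite (set0 : set 'rV[R]_d).
Proof. by move=> B _; rewrite set0I. Qed.

HB.instance Definition _ := gen_eqMixin (point_set R d).
HB.instance Definition _ := gen_choiceMixin (point_set R d).
HB.instance Definition _ :=
  isPointed.Build (point_set R d) (PointSet locally_finite0).

End point_set_instances.

Definition point_config (R : realType) (d : nat) : measurableType _ :=
  g_sigma_algebraType
    (counting_events (@points R d) (@bounded_borel R d)).

Definition cluster (R : realType) (d : nat) := {fset 'rV[R]_d}.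

Definition cluster_measurable (R : realType) (d : nat) :
    set (set (cluster R d)) :=
  <<s counting_events (fun X : cluster R d => [set` X])
                      (@bounded_borel R d) >>.

Definition cluster_locally_finite (R : realType) (d : nat)
    (mu : set (cluster R d)) :=
  forall B : set 'rV[R]_d, bounded_set B ->
    finite_set [set X | mu X /\ [set` X] `&` B !=set0].

Record cluster_set (R : realType) (d : nat) := ClusterSet {
  clusters :> set (cluster R d);
  clusters_lfin : cluster_locally_finite clusters }.

Section cluster_set_instances.
Context (R : realType) (d : nat).

Lemma cluster_locally_finite0 :
  cluster_locally_finite (set0 : set (cluster R d)).
Proof.
move=> B _; rewrite (_ : [set _ | _] = set0)//.
by apply/seteqP; split=> X [].
Qed.

HB.instance Definition _ := gen_eqMixin (cluster_set R d).
HB.instance Definition _ := gen_choiceMixin (cluster_set R d).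
HB.instance Definition _ :=
  isPointed.Build (cluster_set R d) (ClusterSet cluster_locally_finite0).

End cluster_set_instances.

Definition cluster_config (R : realType) (d : nat) : measurableType _ :=
  g_sigma_algebraType
    (counting_events (@clusters R d) (@cluster_measurable R d)).

(* The library's poisson_pmf is constantly 1 at rate 0, which would be wrong
   for sets of intensity zero; here poisson_weight 0 0 = 1 and
   poisson_weight 0 k.+1 = 0. *)
Definition poisson_weight (R : realType) (r : R) (k : nat) : R :=
  expR (- r) * r ^+ k / k`!%:R.

(* Law of the Poisson process with intensity measure Lambda: the counts of
   pairwise disjoint bounded Borel sets are independent Poisson variables. *)
Definition is_poisson_process (R : realType) (d : nat)
    (Lambda : set 'rV[R]_d -> \bar R)
    (P : probability (point_config R d) R) : Prop :=
  forall (n : nat) (B : 'I_n -> set 'rV[R]_d) (k : 'I_n -> nat),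
    (forall i, bounded_borel (B i)) -> trivIset setT B ->
    P [set eta : point_set R d | forall i, eta `&` B i #= `I_(k i)] =
    (\prod_(i < n) poisson_weight (fine (Lambda (B i))) (k i))%:E.

Definition conv_hull (R : realType) (d : nat) (A : set 'rV[R]_d) :
    set 'rV[R]_d :=
  smallest (@convex_set R 'rV[R]_d) A.

Definition hyperplane (R : realType) (d : nat) (u : 'rV[R]_d) (c : R) :
    set 'rV[R]_d :=
  [set x | dotp u x = c].

Definition supporting_hyperplane (R : realType) (d : nat)
    (K H : set 'rV[R]_d) : Prop :=
  exists u c, [/\ u != 0, H = hyperplane u c,
    forall x, K x -> dotp u x <= c & H `&` K !=set0].

Definition discrete_polytope (R : realType) (d : nat) (X : cluster R d) : Prop :=
  forall a, a \in X -> exists2 H,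
    supporting_hyperplane (conv_hull [set` X]) H &
    H `&` conv_hull [set` X] = [set a].

(* The empty face is omitted: faces are only used for tiles that meet. *)
Definition is_face (R : realType) (d : nat) (K F : set 'rV[R]_d) : Prop :=
  F = K \/ exists2 H, supporting_hyperplane K H & F = H `&` K.

Definition vertices (R : realType) (d : nat) (K : set 'rV[R]_d) :
    set 'rV[R]_d :=
  [set x | exists2 H, supporting_hyperplane K H & H `&` K = [set x]].

Definition face_to_face (R : realType) (d : nat) (mu : set (cluster R d)) :
    Prop :=
  forall X Y, mu X -> mu Y ->
    let I := conv_hull [set` X] `&` conv_hull [set` Y] in
    I !=set0 -> is_face (conv_hull [set` X]) I /\ is_face (conv_hull [set` Y]) I.

Definition cluster_tessellation (R : realType) (d : nat)
    (mu : cluster_set R d) : Prop :=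
  [/\ forall X, clusters mu X -> discrete_polytope X,
      forall B : set 'rV[R]_d, bounded_set B ->
        finite_set [set X | clusters mu X /\ conv_hull [set` X] `&` B !=set0] &
      face_to_face mu].

Definition complete (R : realType) (d : nat) (mu : cluster_set R d) : Prop :=
  \bigcup_(X in mu) conv_hull [set` X] = setT.

Definition random_cluster_tessellation (R : realType) (d : nat)
    (Q : probability (cluster_config R d) R) : Prop :=
  {ae Q, forall mu, cluster_tessellation mu}.

Definition complete_random_cluster_tessellation (R : realType) (d : nat)
    (Q : probability (cluster_config R d) R) : Prop :=
  random_cluster_tessellation Q /\ {ae Q, forall mu, complete mu}.

Definition voronoi_cell (R : realType) (d : nat) (eta : set 'rV[R]_d)
    (a : 'rV[R]_d) : set 'rV[R]_d :=
  [set v | forall b, eta b -> edist v a <= edist v b].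

Definition DV (R : realType) (d : nat) (X : cluster R d)
    (eta : point_set R d) : Prop :=
  conv_hull eta = setT /\
  exists2 a, points eta a & [set` X] = vertices (voronoi_cell eta a).

Section psi.
Context (R : realType) (d : nat).

Lemma normr_le_edist (u v : 'rV[R]_d) : `|u - v| <= edist u v.
Proof.
rewrite /edist /Num.norm/= mx_normrE; apply/bigmax_leP; split=> [|[i j] _ /=].
  by rewrite sqrtr_ge0.
rewrite -sqrtr_sqr ler_wsqrtr// ord1 /dotp (bigD1 j)//= -expr2 lerDl sumr_ge0//.
by move=> k _; rewrite -expr2 sqr_ge0.
Qed.

Lemma edist_le_normr (u v : 'rV[R]_d) :
  edist u v <= Num.sqrt (d%:R * `|u - v| ^+ 2).
Proof.
rewrite ler_wsqrtr// /dotp mulr_natl -[X in _ *+ X]card_ord -sumr_const.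
apply: ler_sum => i _; rewrite -expr2 -real_normK ?num_real// lerXn2r ?nnegrE//.
rewrite [leRHS]/Num.norm/= mx_normrE.
exact: (le_bigmax _ (fun ij => `|(u - v) ij.1 ij.2|) (0, i)).
Qed.

Lemma DV_locally_finite (eta : point_set R d) :
  cluster_locally_finite [set X | DV X eta].
Proof.
move=> B /pinfty_ex_gt0[M _ BM].
have [eta0|/set0P[a0 eta0]] := eqVneq (points eta) set0.
  rewrite (_ : [set _ | _] = set0)//.
  apply/seteqP; split=> X // [[_ [a]]].
  by rewrite eta0.
pose r := M + Num.sqrt (d%:R * (M + `|a0|) ^+ 2).
have finK : finite_set (points eta `&` [set a | `|a| <= r]).
  apply: points_lfin; exists r; split; first exact: num_real.
  by move=> s rs x /= xr; apply: le_trans (ltW rs).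
apply: sub_finite_set (finite_image
  (fun a => fset_set (vertices (voronoi_cell eta a))) finK).
move=> X [[_ [a etaa Xa]] [v [Xv Bv]]].
exists a; last by rewrite -Xa set_fsetK.
split=> //=.
have va b : points eta b -> edist v a <= edist v b.
  move=> etab; move: Xv; rewrite Xa => -[H _ HK].
  have : (H `&` voronoi_cell eta a) v by rewrite HK.
  by move=> [_]; exact.
have vM : `|v| <= M by apply: BM.
rewrite (_ : a = v - (v - a)); last by rewrite subKr.
rewrite (le_trans (ler_normB _ _))// lerD// (le_trans (normr_le_edist _ _))//.
rewrite (le_trans (va _ eta0))// (le_trans (edist_le_normr _ _))//.
rewrite ler_wsqrtr// ler_wpM2l// lerXn2r ?nnegrE//.
  by rewrite addr_ge0// (le_trans _ vM).
by rewrite (le_trans (ler_normB _ _))// lerD2r.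
Qed.

Definition psi_DV (eta : point_config R d) : cluster_config R d :=
  ClusterSet (@DV_locally_finite eta).

End psi.

(* Main.v *)
Require Import Defs.
From HB Require Import structures.
From mathcomp Require Import all_boot all_order all_algebra finmap.
From mathcomp Require Import all_classical all_reals all_analysis.
From mathcomp Require Import measurable_realfun ring lra.

Set Implicit Arguments.
Unset Strict Implicit.
Unset Printing Implicit Defensive.

Import Order.TTheory GRing.Theory Num.Theory.
Import numFieldNormedType.Exports.

Local Open Scope classical_set_scope.
Local Open Scope card_scope.
Local Open Scope ring_scope.

(** The geometry is deterministic: as soon as the convex hull of the point set
    is the whole space, its Voronoi vertex clusters form a complete
    tessellation.  Every cell is then bounded ([voronoi_bounded]), hence the
    hull of its vertices ([conv_hull_vertices]).  Two cells lie on opposite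
    sides of the bisector of their nuclei, and a vertex of one cell on that
    bisector is a vertex of the other ([vertex_neighbour]), so the bisector cuts
    out a common face.  Nearest points exist by local finiteness
    ([voronoi_cover]), so the cells cover the space.  Almost surely a Poisson
    configuration meets every orthant of the form N < s_i x_i, because such an
    orthant contains boxes of arbitrarily large volume, and this forces its hull
    to be everything ([poisson_hull_ae]).

    Configurations are only observed through counts, so measurability goes
    through enumerations.  Counts over a countable family of sets that isolates
    each element of a random set make the elements measurable functions of the
    configuration ([measurable_point_in]); conversely, a random set listed by
    countably many measurable partial functions has measurable counts
    ([mpred_card]).  A Voronoi vertex is a circumcenter, which Cramer's rule
    writes as a rational function of finitely many points
    ([vertex_circumcenterP]).  Applying [mpred_card] first to the vertices of
    one cell and then to the clusters of all cells gives [measurable_psi].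

    The almost sure properties concern the law of the image, so the exceptional
    event has to lie inside a null event that is measurable in the space of
    cluster configurations.  The event [certified] serves for this: it replaces
    the real hyperplanes in the definition of a tessellation by countably many
    conditions with rational data.  It implies being a complete tessellation
    ([certified_tessellation]), and the image satisfies it whenever the hull is
    the whole space ([certified_psi]).  Strict inequalities survive a rational
    perturbation.  The equality defining a common supporting hyperplane does
    not, and that hyperplane is recovered as a limit of rational ones that
    almost support both tiles ([separation_certificateP]). *)

(** * Measurable predicates and cardinalities *)

Section measurable_predicates.
Context {disp} {T : measurableType disp}.
Implicit Types P Q : T -> Prop.

(** A predicate-valued form of measurability: the closure lemmas below then
    follow the syntax of a formula with countable quantifiers. *)
Definition mpred P := measurable [set x | P x].

Lemma mpred_ext P Q : (forall x, P x <-> Q x) -> mpred P -> mpred Q.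
Proof.
move=> PQ; rewrite /mpred (_ : [set x | P x] = [set x | Q x])//.
by apply/seteqP; split=> x /= /PQ.
Qed.

Lemma mpred_cst (A : Prop) : mpred (fun=> A).
Proof.
rewrite /mpred; have [a|na] := pselect A.
- by rewrite (_ : [set _ | _] = setT)//; apply/seteqP; split.
- by rewrite (_ : [set _ | _] = set0)//; apply/seteqP; split.
Qed.

Lemma mpred_not P : mpred P -> mpred (fun x => ~ P x).
Proof. by move=> mP; exact: measurableC. Qed.

Lemma mpred_and P Q : mpred P -> mpred Q -> mpred (fun x => P x /\ Q x).
Proof. by move=> mP mQ; exact: measurableI. Qed.

Lemma mpred_or P Q : mpred P -> mpred Q -> mpred (fun x => P x \/ Q x).
Proof. by move=> mP mQ; exact: measurableU. Qed.

Lemma mpred_imp P Q : mpred P -> mpred Q -> mpred (fun x => P x -> Q x).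
Proof.
move=> /mpred_not mP mQ; apply: mpred_ext (mpred_or mP mQ) => x.
by split=> [[]//|PQ]; have [/PQ|] := pselect (P x); [right|left].
Qed.

Lemma mpred_iff P Q : mpred P -> mpred Q -> mpred (fun x => P x <-> Q x).
Proof. by move=> mP mQ; apply: mpred_and; exact: mpred_imp. Qed.

Lemma mpred_ex (I : countType) (P : I -> T -> Prop) :
  (forall i, mpred (P i)) -> mpred (fun x => exists i, P i x).
Proof.
move=> mP; have := countable_bigcupT_measurable (countableP [set: I]) mP.
by congr measurable; apply/seteqP; split=> x /= [i]; [move=> _|]; exists i.
Qed.

Lemma mpred_all (I : countType) (P : I -> T -> Prop) :
  (forall i, mpred (P i)) -> mpred (fun x => forall i, P i x).
Proof.
move=> mP; have /mpred_not := mpred_ex (fun i => mpred_not (mP i)).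
by apply: mpred_ext => x; rewrite -forallNE; split=> h i; [exact: contrapT|].
Qed.

End measurable_predicates.

Lemma mpred_comp d1 d2 (T1 : measurableType d1) (T2 : measurableType d2)
    (f : T1 -> T2) (P : T2 -> Prop) :
  measurable_fun setT f -> mpred P -> mpred (P \o f).
Proof. by move=> mf mP; rewrite /mpred -[X in measurable X]setTI; exact: mf. Qed.

Section real_predicates.
Context {disp} {T : measurableType disp} {R : realType}.
Implicit Types f g : T -> R.

Lemma mpred_ler f g : measurable_fun setT f -> measurable_fun setT g ->
  mpred (fun x => f x <= g x).
Proof.
move=> mf mg.
have := measurable_fun_ler mf mg measurableT (I : measurable [set true]).
by rewrite setTI.
Qed.

Lemma mpred_ltr f g : measurable_fun setT f -> measurable_fun setT g ->
  mpred (fun x => f x < g x).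
Proof.
move=> mf mg.
have := measurable_fun_ltr mf mg measurableT (I : measurable [set true]).
by rewrite setTI.
Qed.

Lemma measurable_invr f : measurable_fun setT f ->
  measurable_fun setT (fun x => (f x)^-1).
Proof.
move=> mf; suff mi : measurable_fun [set: R] (@GRing.inv R).
  exact: measurableT_comp mi mf.
have m0 : measurable [set 0 : R] by [].
rewrite -(setUv [set 0 : R]); apply/measurable_funU => //; first exact: measurableC.
split; first exact: measurable_fun_set1.
apply: open_continuous_measurable_fun => [|x].
  by rewrite openC; apply: accessible_closed_set1; exact: hausdorff_accessible.
by rewrite inE => /eqP x0; exact: inv_continuous.
Qed.

End real_predicates.

Section cardinality.
Context {T : Type}.
Implicit Types S : set T.

Lemma card_geP S k :
  (`I_k #<= S) <-> exists f : 'I_k -> T, injective f /\ forall i, S (f i).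
Proof.
rewrite (card_le_eql card_II); split=> [/card_leP[f]|[f [fi Sf]]].
  exists (fun i => val (f (SigSub (mem_setT i)))); split=> [i j|i].
    by move/val_inj => /(@inj _ _ _ f) => /(_ (mem_setT _) (mem_setT _)) [].
  by have := set_valP (f (SigSub (mem_setT i))).
have /injfunPex[g] : exists2 f : 'I_k -> T, set_fun [set: 'I_k] S f & set_inj [set: 'I_k] f.
  by exists f => [i _|i j _ _ /fi].
exact: inj_card_le.
Qed.

Lemma card_eqII_ge S k : (S #= `I_k) <-> (`I_k #<= S) /\ ~ (`I_k.+1 #<= S).
Proof.
split=> [Sk|[kS kS1]].
  by rewrite !(card_le_eqr Sk) card_lexx card_le_II ltnn.
have Sfin : finite_set S.
  apply: contrapT => /infiniteP; apply: contra_not kS1.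
  by apply: card_le_trans; exact: card_leT.
have [n Sn] := Sfin; rewrite (card_eql Sn); apply/card_eq_II/eqP.
move: kS kS1; rewrite !(card_le_eqr Sn) !card_le_II => kn /negP.
by rewrite -leqNgt => nk; rewrite eqn_leq nk kn.
Qed.

Lemma card_eq1P S : (S #= `I_1) <-> exists x, S = [set x].
Proof.
split=> [/card_eqII_ge[/card_geP[f [_ Sf]] S2]|[x ->]]; last exact: card_set1.
exists (f ord0); apply/seteqP; split=> [y Sy|_ ->]; last exact: Sf.
apply: contrapT; rewrite /= => yf; apply: S2; apply/card_geP.
(* two distinct elements would give an injection of a pair *)
exists (fun i : 'I_2 => if i == ord0 then y else f ord0); split.
  move=> i j; case: ifPn => i0; case: ifPn => j0 //.
  - by rewrite (eqP i0) (eqP j0).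
  - by move=> /esym/yf.
  move=> _; apply/val_inj; case: i i0 => -[//|[|//]] ? _.
  by case: j j0 => -[//|[|//]].
by move=> i; case: ifP.
Qed.

Lemma card_eq0P S : (S #= `I_0) <-> S = set0.
Proof. by rewrite II0 card_eq0; split=> [/eqP|->]. Qed.

End cardinality.

(** * Random sets described by their counts *)

Section measurable_selection.
Context {disp disp'} {Om : measurableType disp} {T : measurableType disp'}.
Variables (S : Om -> set T) (I : countType) (D : I -> set T).
Hypothesis mSD : forall i A, measurable A ->
  forall k, mpred (fun w => S w `&` (D i `&` A) #= `I_k).
Hypothesis isoSD : forall w x, S w x -> exists i, S w `&` D i = [set x].

(** Countably many test sets D i serve to designate the elements of the random
    set. *)
Definition meets_once i w := S w `&` D i #= `I_1.

Definition point_in i w : T := if `[< meets_once i w >] then get (S w `&` D i) else point.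

Lemma meets_onceE i w : meets_once i w -> S w `&` D i = [set point_in i w].
Proof.
move=> iw; rewrite /point_in asboolT//.
have /card_eq1P[x Sx] := iw; rewrite Sx.
by have /getPex -> : [set x] !=set0 by exists x.
Qed.

Lemma point_in_enum w x : S w x <-> exists i, meets_once i w /\ point_in i w = x.
Proof.
split=> [/isoSD[i SDx]|[i [/meets_onceE + <-]]]; last first.
  by move/seteqP => [_ /(_ _ erefl)] [].
have iw : meets_once i w by apply/card_eq1P; exists x.
by exists i; split=> //; move: SDx; rewrite meets_onceE// => /seteqP[_ ]/(_ x erefl) ->.
Qed.

Lemma mpred_meets_once i : mpred (meets_once i).
Proof.
by have := mSD i measurableT 1; apply: mpred_ext => w; rewrite setIT.
Qed.

(** Where the element is isolated, its position is read off a count: it lies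
    in A exactly when intersecting the isolating set with A still leaves one
    element. *)
Lemma measurable_point_in i : measurable_fun setT (point_in i).
Proof.
move=> _ A mA; rewrite setTI.
suff : mpred (fun w => (meets_once i w /\ S w `&` (D i `&` A) #= `I_1) \/
   (~ meets_once i w /\ A point)).
  apply: mpred_ext => w; rewrite /preimage/=.
  have [iw|iw] := pselect (meets_once i w); last first.
    rewrite /point_in asboolF//; split=> [[[]//|[]//]|]; by right.
  rewrite setIA meets_onceE//; split=> [[[_ /card_eq1P[x /seteqP[_ /(_ _ erefl)]]]|[]//]|Aw].
    by move=> [-> ].
  left; split=> //; apply/card_eq1P; exists (point_in i w).
  by rewrite setIC; apply/setIidPr => _ ->.
apply: mpred_or; apply: mpred_and.
- exact: mpred_meets_once.
- exact: mSD.
- exact: mpred_not (mpred_meets_once i).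
- exact: mpred_cst.
Qed.

End measurable_selection.

Section enumerated_counts.
Context {disp disp'} {Om : measurableType disp} {T : measurableType disp'}.
Variables (S : Om -> set T) (I : countType) (E : I -> Om -> Prop) (f : I -> Om -> T).
Hypothesis S_enum : forall w x, S w x <-> exists i, E i w /\ f i w = x.
Hypothesis mEf : forall i A, measurable A -> mpred (fun w => E i w /\ A (f i w)).
Hypothesis mEE : forall i j, mpred (fun w => (E i w /\ E j w) /\ f i w = f j w).

(** Having at least k elements in A means that k indices give pairwise
    distinct values in A, which is a countable condition. Repetitions in the
    enumeration are harmless because distinctness of values is itself
    measurable. *)
Lemma mpred_card_ge A k : measurable A -> mpred (fun w => `I_k #<= S w `&` A).
Proof.
move=> mA.
suff : mpred (fun w => exists t : {ffun 'I_k -> I},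
    (forall i, E (t i) w /\ A (f (t i) w)) /\
    forall i j, i != j -> ~ ((E (t i) w /\ E (t j) w) /\ f (t i) w = f (t j) w)).
  apply: mpred_ext => w; split=> [[t [EA tinj]]|/card_geP[g [ginj Sg]]].
    apply/card_geP; exists (fun i => f (t i) w); split=> [i j fij|i].
      by apply/eqP/negPn/negP => /tinj; apply; case: (EA i); case: (EA j).
    by have [? ?] := EA i; split=> //; apply/S_enum; exists (t i).
  have /choice[t tP] : forall i, exists j, E j w /\ f j w = g i.
    by move=> i; apply/S_enum; have [] := Sg i.
  exists [ffun i => t i]; split=> [i|i j /eqP ij].
    by rewrite ffunE; have [? ->] := tP i; split=> //; have [] := Sg i.
  rewrite !ffunE => -[_]; rewrite (tP i).2 (tP j).2 => /ginj.
  exact: ij.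
apply: mpred_ex => t; apply: mpred_and; first by apply: mpred_all => i; exact: mEf.
by do 2!(apply: mpred_all => ?); apply: mpred_imp; [exact: mpred_cst|exact: mpred_not].
Qed.

Lemma mpred_card A k : measurable A -> mpred (fun w => S w `&` A #= `I_k).
Proof.
move=> mA.
have := mpred_and (mpred_card_ge k mA) (mpred_not (mpred_card_ge k.+1 mA)).
by apply: mpred_ext => w; rewrite card_eqII_ge.
Qed.

End enumerated_counts.

(** The restriction to the event E allows f to be a partial function, with an
    arbitrary value outside E. *)
Lemma measurable_of_gen disp (Om : measurableType disp) (T : pointedType)
    (G : set (set T)) (E : Om -> Prop) (f : Om -> T) :
  mpred E -> (forall A, G A -> mpred (fun w => E w /\ A (f w))) ->
  forall A, <<s G >> A -> mpred (fun w => E w /\ A (f w)).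
Proof.
move=> mE mG; apply: smallest_sub; last exact: mG.
split=> [|A mA|F mF].
- by apply: mpred_ext (mpred_cst False) => w; split=> [|[]].
- apply: mpred_ext (mpred_and mE (mpred_not mA)) => w; split=> [[Ew EA]|[Ew [_ nA]]].
    by split=> //; split=> // Aw; apply: EA.
  by split=> // -[].
apply: mpred_ext (mpred_ex mF) => w; split=> [[i [Ew Fw]]|[Ew [i _ Fw]]].
  by split=> //; exists i.
by exists i.
Qed.

(** * Rational approximation *)

(** Finitely many open conditions can be met together; this is what turns a
    real hyperplane that is strict on a finite set into a rational one. *)
Lemma near_finite (T : choiceType) (U : Type) (F : set_system U) {FF : Filter F} (A : set T)
    (Q : T -> U -> Prop) :
  finite_set A -> (forall x, A x -> \forall p \near F, Q x p) ->
  \forall p \near F, forall x, A x -> Q x p.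
Proof.
move=> /finite_seqP[s ->] {A}; elim: s => [|a s ih] sQ.
  by near=> p => x; rewrite /= in_nil.
have Qa : \forall p \near F, Q a p by apply: sQ; rewrite /= mem_head.
have Qs : \forall p \near F, forall x, [set` s] x -> Q x p.
  by apply: ih => x xs; apply: sQ; rewrite /= in_cons xs orbT.
near=> p => x; rewrite /= in_cons => /orP[/eqP ->|].
  by near: p.
by move: x; near: p.
Unshelve. all: by end_near. Qed.

Section rational_approximation.
Context {R : realType} {d : nat}.
Implicit Types (u x : 'rV[R]_d) (w : 'rV[rat]_d).

Definition ratv w : 'rV[R]_d := map_mx ratr w.

Lemma nbhs_ratv u (A : set 'rV[R]_d) : nbhs u A -> exists w, A (ratv w).
Proof.
move=> /nbhs_ballP[e /= e0 eA].
have /choice[w uw] : forall i, exists q : rat, ball (u 0 i) e (ratr q : R).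
  move=> i; have /rat_in_itvoo[q qi] : u 0 i < u 0 i + e by rewrite ltrDl.
  exists q; rewrite /ball/=; move: qi; rewrite in_itv/= => /andP[q1 q2].
  by rewrite distrC ger0_norm ?subr_ge0 1?ltW// ltrBlDl.
exists (\row_i w i); apply: eA; split=> // i j; rewrite ord1 !mxE.
exact: uw.
Qed.

Lemma nbhs_ratv_pair u (c : R) (A : set ('rV[R]_d * R)) :
  nbhs (u, c) A -> exists w (q : rat), A (ratv w, ratr q).
Proof.
move=> [[/= U V] [uU cV] UVA]; have [w Uw] := nbhs_ratv uU.
have /nbhs_ballP[e /= e0 eV] := cV.
have /rat_in_itvoo[q] : c < c + e by rewrite ltrDl.
rewrite in_itv/= => /andP[q1 q2]; exists w, q; apply: UVA; split=> //=.
by apply: eV; rewrite /ball/= distrC ger0_norm ?subr_ge0 1?ltW// ltrBlDl.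
Qed.

Lemma dotpC u x : dotp u x = dotp x u.
Proof. by apply: eq_bigr => i _; rewrite mulrC. Qed.

Lemma dotpDr u x y : dotp u (x + y) = dotp u x + dotp u y.
Proof. by rewrite -big_split; apply: eq_bigr => i _; rewrite mxE mulrDr. Qed.

Lemma dotpDl u v x : dotp (u + v) x = dotp u x + dotp v x.
Proof. by rewrite dotpC dotpDr !(dotpC x). Qed.

Lemma dotpZr u (t : R) x : dotp u (t *: x) = t * dotp u x.
Proof. by rewrite mulr_sumr; apply: eq_bigr => i _; rewrite mxE mulrCA. Qed.

Lemma dotpZl (t : R) u x : dotp (t *: u) x = t * dotp u x.
Proof. by rewrite dotpC dotpZr dotpC. Qed.

Lemma dotpNr u x : dotp u (- x) = - dotp u x.
Proof. by rewrite -scaleN1r dotpZr mulN1r. Qed.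

Lemma dotpNl u x : dotp (- u) x = - dotp u x.
Proof. by rewrite dotpC dotpNr dotpC. Qed.

Lemma dotpBr u x y : dotp u (x - y) = dotp u x - dotp u y.
Proof. by rewrite dotpDr dotpNr. Qed.

Lemma dotpBl u v x : dotp (u - v) x = dotp u x - dotp v x.
Proof. by rewrite dotpDl dotpNl. Qed.

Lemma dotp0r u : dotp u 0 = 0.
Proof. by rewrite /dotp big1// => i _; rewrite mxE mulr0. Qed.

Lemma dotp0l u : dotp 0 u = 0.
Proof. by rewrite dotpC dotp0r. Qed.

Lemma dotp_ge0 u : 0 <= dotp u u.
Proof. by apply: sumr_ge0 => i _; rewrite -expr2 sqr_ge0. Qed.

Lemma dotp_eq0 u : (dotp u u == 0) = (u == 0).
Proof.
rewrite psumr_eq0 => [|i _]; last by rewrite -expr2 sqr_ge0.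
apply/allP/eqP => [u0|-> i _]; last by rewrite mxE mulr0 eqxx.
apply/rowP => i; rewrite mxE; have := u0 i (mem_index_enum _).
by rewrite -expr2 sqrf_eq0 => /eqP.
Qed.

Lemma dotp_gt0 u : (0 < dotp u u) = (u != 0).
Proof. by rewrite lt_def dotp_ge0 andbT dotp_eq0. Qed.

Lemma dotp_delta u i : dotp u (delta_mx 0 i) = u 0 i.
Proof.
rewrite /dotp (bigD1 i)//= !mxE !eqxx mulr1 big1 ?addr0// => j ji.
by rewrite mxE (negPf ji) andbF mulr0.
Qed.

Lemma continuous_dotp x : continuous (fun u => dotp u x).
Proof.
rewrite /dotp; apply: continuous_big => [|i _ u].
  exact: add_continuous.
exact: cvgM (@coord_continuous R 1 d 0 i u) (cvg_cst _).
Qed.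

Lemma continuous_dotp_sub x : continuous (fun p : 'rV[R]_d * R => dotp p.1 x - p.2).
Proof.
move=> p; apply: cvgB; last exact: cvg_snd.
apply: (@continuous_comp _ _ _ fst (fun u => dotp u x)); first exact: cvg_fst.
exact: continuous_dotp.
Qed.

Lemma continuous_dotpxx : continuous (fun u : 'rV[R]_d => dotp u u).
Proof.
rewrite /dotp; apply: continuous_big => [|i _ u].
  exact: add_continuous.
exact: cvgM (@coord_continuous R 1 d 0 i u) (@coord_continuous R 1 d 0 i u).
Qed.

Lemma normr_coord u i : `|u 0 i| <= `|u|.
Proof.
rewrite [leRHS]/Num.norm/= mx_normrE.
exact: (le_bigmax _ (fun ij => `|u ij.1 ij.2|) (0, i)).
Qed.

Definition rbox_index : countType := ('rV[rat]_d * nat)%type.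

(** Open balls of the sup norm with rational centers: a countable basis, and
    the family of test sets used to isolate points. *)
Definition rbox (i : rbox_index) : set 'rV[R]_d := ball (ratv i.1) (i.2.+1%:R^-1).

Lemma rbox_basis x (e : R) : 0 < e -> exists i, rbox i x /\ rbox i `<=` ball x e.
Proof.
move=> e0; have e20 : 0 < e / 2 by rewrite divr_gt0.
have [n ne] : exists n : nat, n.+1%:R^-1 < e / 2.
  have := near_infty_natSinv_lt (PosNum e20) => -[n _ /(_ n (leqnn n))] /= ne.
  by exists n.
have [|w xw] := @nbhs_ratv x (ball x n.+1%:R^-1).
  exact: nbhsx_ballx.
exists (w, n); split; first exact: ball_sym.
move=> y wy; rewrite (splitr e); apply: (@ball_triangle _ _ (ratv w)).
  by apply: le_ball xw; exact: ltW.
by apply: le_ball wy; exact: ltW.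
Qed.

Lemma rbox_bounded i : bounded_set (rbox i).
Proof.
exists (`|ratv i.1| + i.2.+1%:R^-1); split; first exact: num_real.
move=> M Mlt y; rewrite /rbox /= mx_norm_ball /ball_/= => yb.
apply/ltW/(le_lt_trans _ Mlt).
rewrite (_ : y = ratv i.1 - (ratv i.1 - y)); last by rewrite subKr.
by rewrite (le_trans (ler_normB _ _))// lerD2l ltW.
Qed.

Lemma rbox_open i : open (rbox i).
Proof. by apply: ball_open; rewrite invr_gt0. Qed.

Lemma finite_isolated (F : set 'rV[R]_d) x : finite_set F ->
  exists2 e : R, 0 < e & forall p, F p -> ball x e p -> p = x.
Proof.
move=> finF.
have : \forall e \near (0 : R)^'+, forall p, F p -> ball x e p -> p = x.
  apply: near_finite => // p Fp.
  have [->|px] := eqVneq p x; first by near=> e.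
  near=> e; rewrite mx_norm_ball /ball_/= => xpe.
  have : e < `|x - p|.
    by near: e; apply: nbhs_right_lt; rewrite normr_gt0 subr_eq0 eq_sym.
  by move/lt_trans => /(_ _ xpe); rewrite ltxx.
move=> fe.
near (0 : R)^'+ => e; exists e; [by []|by near: e].
Unshelve. all: by end_near. Qed.

Lemma finite_lower_bound (T : choiceType) (F : set T) (f : T -> R) : finite_set F ->
  (forall t, F t -> 0 < f t) -> exists2 e : R, 0 < e & forall t, F t -> e < f t.
Proof.
move=> finF f0.
have fe : \forall e \near (0 : R)^'+, forall t, F t -> e < f t.
  by apply: near_finite => // t Ft; apply: nbhs_right_lt; exact: f0.
near (0 : R)^'+ => e; exists e; [by []|by near: e].
Unshelve. all: by end_near. Qed.

End rational_approximation.

(** * Borel sets and cluster counts *)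

HB.instance Definition _ (R : realType) (d : nat) :=
  isPointed.Build (Defs.cluster R d) (fset0 : {fset 'rV[R]_d}).

Definition borel_space (R : realType) (d : nat) : measurableType _ :=
  g_sigma_algebraType (@open 'rV[R]_d).

Definition cluster_space (R : realType) (d : nat) : measurableType _ :=
  g_sigma_algebraType (counting_events (fun X : Defs.cluster R d => [set` X])
                      (@bounded_borel R d)).

Lemma sub_bounded_set (R : realType) (d : nat) (A B : set 'rV[R]_d) :
  A `<=` B -> bounded_set B -> bounded_set A.
Proof. by move=> AB [M [Mr BM]]; exists M; split=> // x Mx y /AB; exact: BM. Qed.

Section borel.
Context {R : realType} {d : nat}.
Local Notation V := (borel_space R d).

Lemma open_borel (A : set 'rV[R]_d) : open A -> measurable (A : set V).
Proof. exact: sub_sigma_algebra. Qed.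

Lemma rbox_borel i : measurable (rbox i : set V).
Proof. by apply: open_borel; exact: rbox_open. Qed.

Lemma continuous_borel (f : 'rV[R]_d -> R) : continuous f ->
  measurable_fun setT (f : V -> R).
Proof.
move=> /continuousP cf; apply: (measurability _ (RGenOpens.measurableE R)).
move=> _ [_ [a [b ->] <-]]; rewrite setTI; apply: open_borel.
exact/cf/interval_open.
Qed.

Lemma measurable_rowP disp (T : measurableType disp) (f : T -> V) :
  measurable_fun setT f <-> forall i, measurable_fun setT (fun t => f t 0 i).
Proof.
split=> [mf i|mf].
  exact: measurableT_comp (continuous_borel (@coord_continuous R 1 d 0 i)) mf.
apply: (@measurability _ _ T V setT f (@open _) erefl) => _ [U oU <-]; rewrite setTI.
suff : mpred (fun t => exists i, rbox i `<=` U /\ rbox i (f t)).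
  apply: mpred_ext => t; split=> [[i [iU /iU]]//|Uft].
  have /nbhs_ballP[e /= e0 eU] := open_nbhs_nbhs (conj oU Uft).
  by have [i [fi ie]] := rbox_basis (f t) e0; exists i; split=> // y /ie/eU.
apply: mpred_ex => i; apply: mpred_and; first exact: mpred_cst.
suff : mpred (fun t => forall j, `|ratv i.1 0 j - f t 0 j| < i.2.+1%:R^-1).
  apply: mpred_ext => t; split=> [h|[_ h] j]; last exact: h.
  by split=> [|k j]; [rewrite invr_gt0|rewrite ord1; exact: h].
apply: mpred_all => j; apply: mpred_ltr; last exact: measurable_cst.
apply: measurableT_comp => //; apply: measurable_funB; first exact: measurable_cst.
exact: mf.
Qed.

Lemma measurable_dotp disp (T : measurableType disp) (f g : T -> V) :
  measurable_fun setT f -> measurable_fun setT g ->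
  measurable_fun setT (fun t => dotp (f t) (g t)).
Proof.
move=> /measurable_rowP mf /measurable_rowP mg.
by apply: measurable_sum => i; exact: measurable_funM.
Qed.

Lemma borel_dotp u : measurable_fun setT (fun x : V => dotp u x).
Proof. by apply: measurable_dotp => //; exact: measurable_cst. Qed.

Lemma bounded_borel_bxI i (A : set V) : measurable A -> bounded_borel (rbox i `&` A).
Proof.
move=> mA; split; last exact: (@measurableI _ V _ _ (rbox_borel i) mA).
by apply: sub_bounded_set (rbox_bounded i) => x [].
Qed.

Lemma bounded_borel_rbox i : bounded_borel (rbox i : set 'rV[R]_d).
Proof. by split; [exact: rbox_bounded|exact: rbox_borel]. Qed.

Definition cube (r : R) : set 'rV[R]_d := [set x | `|x| <= r].

Lemma cube_bounded r : bounded_set (cube r).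
Proof.
by exists r; split=> [|M rM x /= xr]; [exact: num_real|exact: le_trans (ltW rM)].
Qed.

Lemma cube_borel r : measurable (cube r : set V).
Proof.
apply: (mpred_ler (f := fun x : V => `|x|)); last exact: measurable_cst.
by apply: continuous_borel; exact: norm_continuous.
Qed.

Lemma in_cube x : exists N : nat, cube N%:R x.
Proof. by exists (Num.bound `|x|); apply/ltW; rewrite archi_boundP. Qed.
End borel.

Section cluster_measurability.
Context {R : realType} {d : nat}.
Local Notation V := (borel_space R d).
Local Notation C := (cluster_space R d).
Implicit Types (A : set 'rV[R]_d) (X : Defs.cluster R d).

(** The properties of clusters that have to be measurable are mostly countable
    combinations of these. *)
Definition hits A X := exists2 x, x \in X & A x.

Lemma mpred_cluster_count A k : bounded_borel A ->
  mpred (fun X : C => [set` X] `&` A #= `I_k).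
Proof. by move=> bA; apply: sub_sigma_algebra; exists A => //; exists k. Qed.

(** Only counts in bounded sets are available, so an unbounded set is
    exhausted by cubes. *)
Lemma mpred_hits A : measurable (A : set V) -> mpred (hits A : C -> Prop).
Proof.
move=> mA; suff : mpred (fun X : C =>
    exists N : nat, ~ ([set` X] `&` (cube N%:R `&` A) #= `I_0)).
  apply: mpred_ext => X; split=> [[N]|[x xX Ax]].
    by rewrite card_eq0P => /eqP/set0P[x [xX [_ Ax]]]; exists x.
  have [N xN] := in_cube x; exists N; rewrite card_eq0P; apply/eqP/set0P.
  by exists x.
apply: mpred_ex => N; apply: mpred_not; apply: mpred_cluster_count; split.
  by apply: sub_bounded_set (cube_bounded N%:R) => x [].
exact: (@measurableI _ V _ _ (cube_borel _) mA).
Qed.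

End cluster_measurability.

(** * Measurable enumeration of configurations *)

Lemma norm_le_ball (R : realType) (d : nat) (x y : 'rV[R]_d) e :
  ball x e y -> `|y| <= `|x| + e.
Proof.
rewrite mx_norm_ball /ball_/= => /ltW xye.
rewrite (_ : y = x - (x - y)); last by rewrite subKr.
by rewrite (le_trans (ler_normB _ _))// lerD2l.
Qed.

Section point_enumeration.
Context {R : realType} {d : nat}.
Local Notation V := (borel_space R d).
Local Notation N := (point_config R d).
Implicit Types (eta : point_config R d).

Let S : N -> set V := fun eta => points eta.

Let mS i (A : set V) : measurable A ->
  forall k, mpred (fun eta => S eta `&` (rbox i `&` A) #= `I_k).
Proof.
move=> mA k; apply: sub_sigma_algebra.
by exists (rbox i `&` A); [exact: bounded_borel_bxI|exists k].
Qed.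

Let isoS eta x : S eta x -> exists i, S eta `&` rbox i = [set x].
Proof.
move=> ex.
(* capping the radius at 1 keeps the competing points in a bounded set *)
have [e1 e10 xe1] : exists2 e : R, 0 < e & forall p, points eta p -> ball x e p -> p = x.
  have [e' e'0 xe'] := @finite_isolated _ _ (points eta `&` cube (`|x| + 1)) x
    (points_lfin eta (cube_bounded _)).
  exists (Num.min e' 1); first by rewrite lt_min e'0 ltr01.
  move=> p etap xp; apply: xe'; last by apply: le_ball xp; rewrite ge_min lexx.
  split=> //; have : ball x 1 p by apply: le_ball xp; rewrite ge_min lexx orbT.
  by rewrite /cube/=; exact: norm_le_ball.
have [i [xi ie]] := rbox_basis x e10; exists i; apply/seteqP; split=> [p [etap]|_ ->].
  by move=> /ie; exact: xe1.
by split.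
Qed.

Definition single_point : rbox_index -> N -> Prop := meets_once S rbox.
Definition point_at : rbox_index -> N -> V := point_in S rbox.

Lemma point_at_enum eta x : points eta x <-> exists i, single_point i eta /\ point_at i eta = x.
Proof. exact: (point_in_enum isoS). Qed.

Lemma point_at_mem i eta : single_point i eta -> points eta (point_at i eta).
Proof. by move=> ?; apply/point_at_enum; exists i. Qed.

Lemma mpred_single_point i : mpred (single_point i).
Proof. exact: mpred_meets_once. Qed.

Lemma measurable_point_at i : measurable_fun setT (point_at i).
Proof. exact: measurable_point_in. Qed.

End point_enumeration.

Section cluster_enumeration.
Context {R : realType} {d : nat}.
Local Notation C := (cluster_space R d).
Local Notation M := (cluster_config R d).
Implicit Types (X Y : Defs.cluster R d) (mu : M).

Let S : M -> set C := fun mu => clusters mu.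

(** A cluster is isolated among finitely many others by putting one small box
    around each of its points: another cluster that meets each box and stays
    in their union has the same points. The empty list isolates the empty
    cluster. *)
Definition fits (Q : seq rbox_index) X : Prop :=
  (forall i, i \in Q -> hits (rbox i) X) /\
  ~ hits [set x | forall i, i \in Q -> ~ rbox i x] X.

Lemma mpred_fits Q : mpred (fits Q : C -> Prop).
Proof.
apply: mpred_and.
  apply: mpred_all => i; apply: mpred_imp; first exact: mpred_cst.
  by apply: mpred_hits; exact: rbox_borel.
apply: mpred_not; apply: mpred_hits.
apply: (@mpred_all _ (borel_space R d)) => i; apply: mpred_imp; first exact: mpred_cst.
by apply: mpred_not; exact: rbox_borel.
Qed.

Let D (Q : seq rbox_index) : set C := [set X | fits Q X].

Let mS Q (A : set C) : measurable A ->
  forall k, mpred (fun mu => S mu `&` (D Q `&` A) #= `I_k).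
Proof.
move=> mA k; apply: sub_sigma_algebra; exists (D Q `&` A).
  exact: (@measurableI _ C _ _ (mpred_fits Q) mA).
by exists k.
Qed.

Lemma cluster_cube X : exists r : R, forall x, x \in X -> cube r x.
Proof.
exists (\sum_(x <- X) `|x|) => x xX; rewrite /cube/=.
by rewrite (big_rem x)//= lerDl sumr_ge0.
Qed.

Let isoS mu X : S mu X -> exists Q, S mu `&` D Q = [set X].
Proof.
move=> muX; have [r Xr] := cluster_cube X.
(* any cluster that meets a box around a point of X lies in F *)
pose F := [set Y | clusters mu Y /\ [set` Y] `&` cube (r + 1) !=set0].
have finF : finite_set F := clusters_lfin mu (cube_bounded (r + 1)).
pose FP := \bigcup_(Y in F) [set` Y].
have finFP : finite_set FP by apply: bigcup_finite => // Y _; exact: finite_fset.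
have /choice[q qP] : forall x, exists i,
    [/\ rbox i x, rbox i `<=` ball x 1 & forall p, FP p -> rbox i p -> p = x].
  move=> x; have [e e0 xe] := finite_isolated x finFP.
  have e10 : 0 < Num.min e 1 by rewrite lt_min e0 ltr01.
  have [i [xi ie]] := rbox_basis x e10; exists i; split=> // [p /ie|p Fp /ie pe].
    by apply: le_ball; rewrite ge_min lexx orbT.
  by apply: xe => //; apply: le_ball pe; rewrite ge_min lexx.
exists [seq q x | x <- X]; apply/seteqP; split=> [Y [muY [Yhit Yin]]|_ ->]; last first.
  split=> //; split=> [_ /mapP[x xX ->]|[x xX /(_ (q x))]].
    by exists x => //; have [] := qP x.
  by case: (qP x) => xq _ _; apply => //; exact: map_f.
have YF x : x \in X -> F Y.
  move=> xX; split=> //; have [y yY yq] := Yhit _ (map_f q xX).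
  exists y; split=> //; have [_ /(_ _ yq) + _] := qP x.
  by move=> /norm_le_ball yx; rewrite /cube/= (le_trans yx)// lerD2r Xr.
have XY x : x \in X -> x \in Y.
  move=> xX; have [y yY yq] := Yhit _ (map_f q xX).
  have [_ _ /(_ y)<-//] := qP x.
  by exists Y => //; exact: YF xX.
apply/fsetP => y; apply/idP/idP => [yY|]; last exact: XY.
have [x xX yq] : exists2 x, x \in X & rbox (q x) y.
  apply: contrapT => /forall2NP nx; apply: Yin; exists y => // _ /mapP[x xX ->].
  by have [] := nx x.
by have [_ _ /(_ y)->//] := qP x; exists Y => //; exact: YF xX.
Qed.

Definition single_cluster : seq rbox_index -> M -> Prop := meets_once S D.
Definition cluster_at : seq rbox_index -> M -> C := point_in S D.

Lemma cluster_at_enum mu X : clusters mu X <-> exists i, single_cluster i mu /\ cluster_at i mu = X.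
Proof. exact: (point_in_enum (D := D) isoS). Qed.

Lemma mpred_single_cluster i : mpred (single_cluster i).
Proof. exact: mpred_meets_once. Qed.

Lemma measurable_cluster_at i : measurable_fun setT (cluster_at i).
Proof. exact: measurable_point_in. Qed.

Lemma mpred_all_clusters (P : C -> Prop) : mpred P ->
  mpred (fun mu : M => forall X, clusters mu X -> P X).
Proof.
move=> mP; suff : mpred (fun mu : M => forall i, single_cluster i mu -> P (cluster_at i mu)).
  apply: mpred_ext => mu; split=> [h X /cluster_at_enum[i [imu <-]]|h i imu]; first exact: h.
  by apply: h; apply/cluster_at_enum; exists i.
apply: mpred_all => i; apply: mpred_imp; first exact: mpred_single_cluster.
exact: mpred_comp (measurable_cluster_at i) mP.
Qed.

Lemma mpred_ex_cluster (P : C -> Prop) : mpred P ->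
  mpred (fun mu : M => exists X, clusters mu X /\ P X).
Proof.
move=> /mpred_not/mpred_all_clusters/mpred_not; apply: mpred_ext => mu; split.
  by apply: contra_notP => /forallNP h X muX PX; apply: (h X).
by move=> [X [muX PX]] /(_ X muX); exact.
Qed.

End cluster_enumeration.

(** * Convex hulls and separation *)

Section convexity.
Context {R : realType} {d : nat}.
Implicit Types (A B : set 'rV[R]_d) (u x y : 'rV[R]_d) (t c : R).

Lemma convexP A : convex_set A <-> forall x y t, A x -> A y -> 0 <= t -> t <= 1 ->
  A (t *: x + (1 - t) *: y).
Proof.
split=> [cA x y t Ax Ay t0 t1|cA x y t /set_mem Ax /set_mem Ay].
  have := cA x y (Itv01 t0 t1) (mem_set Ax) (mem_set Ay) => /set_mem.
  by [].
by apply/mem_set/cA.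
Qed.

Lemma dotpBB u v : dotp (u - v) (u - v) = dotp u u - 2 * dotp u v + dotp v v.
Proof. by rewrite dotpBl !dotpBr (dotpC v u); ring. Qed.

Lemma conv_hull_convex A : convex_set (conv_hull A).
Proof.
apply/convexP => x y t Ax Ay t0 t1 B [cB AB].
by move/convexP : (cB); apply => //; [exact: Ax|exact: Ay].
Qed.

Lemma sub_conv_hull A : A `<=` conv_hull A.
Proof. exact: sub_gen_smallest. Qed.

Lemma conv_hull_sub A B : convex_set B -> A `<=` B -> conv_hull A `<=` B.
Proof. exact: smallest_sub. Qed.

Lemma conv_hull_mono A B : A `<=` B -> conv_hull A `<=` conv_hull B.
Proof.
move=> AB; apply: conv_hull_sub; first exact: conv_hull_convex.
exact: subset_trans AB (@sub_conv_hull B).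
Qed.

Lemma convex_le u c : convex_set [set x | dotp u x <= c].
Proof.
apply/convexP => x y t /= ux uy t0 t1; rewrite dotpDr !dotpZr.
have := ler_wpM2l t0 ux; have /ler_wpM2l/(_ _ _ uy) : 0 <= 1 - t by rewrite subr_ge0.
lra.
Qed.

Lemma convex_lt u c : convex_set [set x | dotp u x < c].
Proof.
apply/convexP => x y t /= ux uy t0 t1; rewrite dotpDr !dotpZr.
have [->|tn0] := eqVneq t 0; first by rewrite mul0r add0r subr0 mul1r.
have tp : 0 < t by rewrite lt_def tn0.
have : t * dotp u x < t * c by rewrite ltr_pM2l.
have /ler_wpM2l/(_ _ _ (ltW uy)) : 0 <= 1 - t by rewrite subr_ge0.
lra.
Qed.

Lemma conv_hull_le A u c : (forall x, A x -> dotp u x <= c) ->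
  forall x, conv_hull A x -> dotp u x <= c.
Proof. by move=> Auc; apply: conv_hull_sub Auc; exact: convex_le. Qed.

Lemma conv_hull_lt A u c : (forall x, A x -> dotp u x < c) ->
  forall x, conv_hull A x -> dotp u x < c.
Proof. by move=> Auc; apply: conv_hull_sub Auc; exact: convex_lt. Qed.

(** The points of the hull that are either strictly below the hyperplane or in
    the hull of the contact set form a convex set, so no explicit convex
    combination is needed. *)
Lemma conv_hull_face A u c : (forall x, A x -> dotp u x <= c) ->
  forall x, conv_hull A x -> dotp u x = c -> conv_hull (A `&` hyperplane u c) x.
Proof.
move=> Auc; pose H := conv_hull (A `&` hyperplane u c).
suff AH : conv_hull A `<=` [set x | dotp u x < c \/ H x].
  by move=> x /AH[ux uxc|//]; move: ux; rewrite uxc ltxx.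
have Hc x : H x -> dotp u x = c.
  move=> Hx; apply/eqP; rewrite eq_le (conv_hull_le _ Hx)/=; last first.
    by move=> z [_ ->].
  rewrite -lerN2 -dotpNl; apply: conv_hull_le Hx => z [_ /= <-].
  by rewrite dotpNl.
apply: conv_hull_sub; last first.
  move=> x Ax /=; have := Auc _ Ax; rewrite le_eqVlt => /orP[/eqP uxc|]; last by left.
  by right; apply: sub_conv_hull.
apply/convexP => x y t xH yH t0 t1.
have lec z : dotp u z < c \/ H z -> dotp u z <= c by move=> [/ltW//|/Hc ->].
have [t00|tn0] := eqVneq t 0; first by rewrite t00 scale0r add0r subr0 scale1r.
(* for 0 < t < 1, one strict inequality makes the combination strict *)
have [t11|tn1] := eqVneq t 1; first by rewrite t11 scale1r subrr scale0r addr0.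
have tp : 0 < t by rewrite lt_def tn0.
have tl1 : t < 1 by rewrite lt_neqAle tn1.
case: xH => [ux|Hx].
  left; rewrite dotpDr !dotpZr; have := lec y yH.
  have : t * dotp u x < t * c by rewrite ltr_pM2l.
  have /ler_wpM2l h : 0 <= 1 - t by rewrite subr_ge0.
  by move=> + /h; lra.
case: yH => [uy|Hy].
  left; rewrite dotpDr !dotpZr (Hc _ Hx).
  have : (1 - t) * dotp u y < (1 - t) * c by rewrite ltr_pM2l ?subr_gt0.
  by lra.
by right; move/convexP: (@conv_hull_convex (A `&` hyperplane u c)); exact.
Qed.

Lemma conv_hull_finite A x : conv_hull A x ->
  exists2 s : seq 'rV[R]_d, (forall y, y \in s -> A y) & conv_hull [set` s] x.
Proof.
move: x; apply: (@conv_hull_sub A [set x | exists2 s : seq 'rV[R]_d,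
  (forall y, y \in s -> A y) & conv_hull [set` s] x]); last first.
  move=> x Ax; exists [:: x]; first by move=> y; rewrite inE => /eqP ->.
  by apply: sub_conv_hull; rewrite /= inE.
apply/convexP => x y t [s1 s1A s1x] [s2 s2A s2y] t0 t1; exists (s1 ++ s2).
  by move=> z; rewrite mem_cat => /orP[/s1A|/s2A].
move/convexP: (@conv_hull_convex [set` s1 ++ s2]); apply => //.
  by apply: conv_hull_mono s1x => z /= zs; rewrite mem_cat zs.
by apply: conv_hull_mono s2y => z /= zs; rewrite mem_cat zs orbT.
Qed.

(** With an arbitrary positive total weight, the statement passes to the tail
    of the list. *)
Lemma convex_sum (I : eqType) (r : seq I) A (t : I -> R) (p : I -> 'rV[R]_d) :
  convex_set A -> (forall i, 0 <= t i) -> (forall i, A (p i)) ->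
  0 < \sum_(i <- r) t i ->
  A ((\sum_(i <- r) t i)^-1 *: \sum_(i <- r) t i *: p i).
Proof.
move=> /convexP cA t0 Ap; elim: r => [|i r ih]; first by rewrite big_nil ltxx.
rewrite !big_cons; set T := \sum_(j <- r) t j; set P := \sum_(j <- r) _ *: _.
have T0 : 0 <= T by exact: sumr_ge0.
have [Tz|Tn0] := eqVneq T 0.
  have -> : P = 0.
    rewrite /P big1_seq// => j /andP[_ jr]; suff -> : t j = 0 by rewrite scale0r.
    move/eqP: Tz; rewrite /T psumr_eq0 => [/allP/(_ j jr)/eqP//|k _]; exact: t0.
  by rewrite Tz !addr0 => ti0; rewrite scalerA mulVf ?scale1r ?gt_eqF.
have Tp : 0 < T by rewrite lt_def Tn0.
move=> iT; have := cA (p i) (T^-1 *: P) (t i / (t i + T)) (Ap i) (ih Tp).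
have -> : (1 - t i / (t i + T)) = T / (t i + T) by field; rewrite gt_eqF.
rewrite scalerA mulrAC divff// mul1r scalerDr scalerA mulrC; apply.
  by rewrite mulr_ge0// invr_ge0 ltW.
by rewrite mulrC ler_pdivrMr// mul1r lerDl.
Qed.

Lemma conv_hull_sum (n : nat) A (t : 'I_n -> R) (p : 'I_n -> 'rV[R]_d) :
  (forall i, 0 <= t i) -> (forall i, A (p i)) -> \sum_i t i = 1 ->
  conv_hull A (\sum_i t i *: p i).
Proof.
move=> t0 Ap t1.
have := convex_sum (r := index_enum 'I_n) (@conv_hull_convex A) t0
  (fun i => sub_conv_hull (Ap i)).
by rewrite t1 ltr01 invr1 scale1r; exact.
Qed.

Lemma simplex_compact n :
  compact [set t : 'rV[R]_n | (forall i, 0 <= t 0 i) /\ \sum_i t 0 i = 1].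
Proof.
have -> : [set t : 'rV[R]_n | (forall i, 0 <= t 0 i) /\ \sum_i t 0 i = 1] =
    [set t : 'rV[R]_n | forall i, `[0, 1]%classic (t 0 i)] `&`
    (fun t : 'rV[R]_n => dotp t (const_mx 1)) @^-1` [set x | x = 1].
  have dt (t : 'rV[R]_n) : dotp t (const_mx 1) = \sum_(i < n) t 0 i :> R.
    by apply: eq_bigr => i _; rewrite mxE mulr1.
  apply/seteqP; split=> t /=; rewrite dt => -[t0 t1]; split=> // i; last first.
    by have := t0 i; rewrite in_itv/= => /andP[].
  by rewrite in_itv/= t0/= -t1 (bigD1 i)//= lerDl sumr_ge0.
apply: compact_closedI.
  by apply: (@rV_compact R _ (fun=> `[0, 1]%classic)) => _; exact: segment_compact.
move/continuous_closedP: (@continuous_dotp R n (const_mx 1)); apply.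
exact: closed_eq.
Qed.

(** The normal is q minus the point of the hull closest to q, which exists
    because the hull is the image of a compact simplex. *)
Lemma finite_separation (s : seq 'rV[R]_d) q : ~ conv_hull [set` s] q ->
  exists u, forall x, x \in s -> dotp u x < dotp u q.
Proof.
case: s => [_|a s]; first by exists 0.
set n := size (a :: s) => qs; pose p (i : 'I_n) := (a :: s)`_i.
pose K := [set t : 'rV[R]_n | (forall i, 0 <= t 0 i) /\ \sum_i t 0 i = 1].
pose comb (t : 'rV[R]_n) := \sum_i t 0 i *: p i.
have pE x : x \in a :: s -> exists t : 'rV[R]_n, K t /\ comb t = x.
  move=> xs; have xn : (index x (a :: s) < n)%N by rewrite index_mem.
  exists (delta_mx 0 (Ordinal xn)); split; first split.
  - by move=> i; rewrite mxE ler0n.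
  - rewrite (bigD1 (Ordinal xn))//= mxE !eqxx big1 ?addr0// => i ni.
    by rewrite mxE (negPf ni) andbF.
  - rewrite /comb (bigD1 (Ordinal xn))//= mxE !eqxx scale1r big1 ?addr0.
      by rewrite /p /= nth_index.
    by move=> i ni; rewrite mxE (negPf ni) andbF scale0r.
have K0 : K !=set0 by have [t [Kt _]] := pE a (mem_head _ _); exists t.
have ccomb : continuous comb.
  apply: continuous_big => [|i _ t]; first exact: add_continuous.
  exact: cvgZr_tmp (@coord_continuous R 1 n 0 i t).
have cf : continuous (fun t : 'rV[R]_n => dotp (q - comb t) (q - comb t)).
  move=> t; apply: (@continuous_comp _ _ _ (fun t : 'rV[R]_n => q - comb t) (fun u => dotp u u)).
    exact: (continuousB (@cst_continuous _ _ q t) (ccomb t)).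
  exact: continuous_dotpxx.
have [t /set_mem[t0 t1] tmin] :=
  compact_EVT_min K0 (@simplex_compact n) (continuous_subspaceT cf).
have combq : comb t != q.
  apply/eqP => e; apply: qs; rewrite -e; apply: conv_hull_sum => // i.
  exact: mem_nth.
exists (q - comb t) => x xs; have [t' [[t'0 t'1] <-]] := pE _ xs.
set v := comb t' - comb t.
have dv : dotp (q - comb t) v <= 0.
  rewrite leNgt; apply/negP => D0; set D := dotp _ v in D0.
  (* moving from the closest point towards comb t' cannot decrease the
     distance to q *)
  have key (e : R) : 0 < e -> e <= 1 -> 2 * D <= e * dotp v v.
    move=> e0 e1; have Ke : K (e *: t' + (1 - e) *: t).
      split=> [j|].
        by rewrite !mxE addr_ge0// mulr_ge0 ?subr_ge0// ltW.
      under eq_bigr do rewrite !mxE.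
      by rewrite big_split/= -!mulr_sumr t1 t'1; ring.
    have := tmin _ (mem_set Ke).
    have -> : comb (e *: t' + (1 - e) *: t) = comb t + e *: v.
      rewrite /v /comb -sumrB scaler_sumr -big_split/=; apply: eq_bigr => j _.
      by rewrite !mxE -scalerBl scalerA -scalerDl; congr (_ *: _); ring.
    rewrite opprD addrA [in leRHS]dotpBB !dotpZr dotpZl -/D => tm.
    by rewrite -(ler_pM2l e0); lra.
  have V2 := key 1 ltr01 (lexx _); rewrite mul1r in V2.
  have V0 : 0 < dotp v v by lra.
  (* this step length would give 2 D <= D *)
  have := key (D / dotp v v); rewrite divr_gt0// ler_pdivrMr// divfK ?gt_eqF//.
  by move=> /(_ isT); lra.
have : 0 < dotp (q - comb t) (q - comb t) by rewrite dotp_gt0 subr_eq0 eq_sym.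
by move: dv; rewrite /v !dotpBr; lra.
Qed.

End convexity.

(** * Hull criteria and common faces *)

Section hull_criteria.
Context {R : realType} {d : nat}.
Implicit Types (A B : set 'rV[R]_d) (u x y : 'rV[R]_d) (c : R).

Definition sgnv (s : {ffun 'I_d -> bool}) : 'rV[R]_d := \row_i (-1) ^+ s i.

(** If x were separated from the hull by a direction u, the point found in the
    orthant with the signs of u would be on the wrong side. *)
Lemma conv_hull_orthants A x :
  (forall s : {ffun 'I_d -> bool},
    exists b, A b /\ forall i, 0 <= (-1) ^+ s i * (b 0 i - x 0 i)) ->
  conv_hull A x.
Proof.
move=> /choice[b bP]; apply: contrapT => nAx.
have /finite_separation[u us] : ~ conv_hull [set` codom b] x.
  by apply: contra_not nAx; apply: conv_hull_mono => _ /= /codomP[s ->]; case: (bP s).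
have := us _ (codom_f b [ffun i => u 0 i < 0]); apply/negP; rewrite -leNgt.
rewrite -subr_ge0 -dotpBr; apply: sumr_ge0 => i _.
have [_ /(_ i)] := bP [ffun i => u 0 i < 0]; rewrite ffunE !mxE.
by case: ltP => ui; [rewrite expr1 mulN1r oppr_ge0 => /(mulr_le0 (ltW ui))|
  rewrite mul1r => /(mulr_ge0 ui)].
Qed.

Lemma conv_hull_ratP (s : seq 'rV[R]_d) x : conv_hull [set` s] x <->
  forall w, exists2 y, y \in s & 0 <= dotp (ratv w) (y - x).
Proof.
split=> [sx w|sx].
  apply: contrapT => /forall2NP h.
  suff : dotp (ratv w) x < dotp (ratv w) x by rewrite ltxx.
  apply: (conv_hull_lt _ sx) => y ys; rewrite ltNge; apply/negP => xy.
  by have [//|] := h y; rewrite dotpBr subr_ge0.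
apply: contrapT => /finite_separation[u us].
have : \forall v \near u, forall y, [set` s] y -> dotp v (y - x) < 0.
  apply: (near_finite (F := nbhs u) (Q := fun y v => dotp v (y - x) < 0)) => [|y /us].
    exact: finite_seq.
  by rewrite -subr_lt0 -dotpBr => /cvgr_lt; apply; exact: continuous_dotp.
move=> /nbhs_ratv[w ws]; have [y ys] := sx w.
by rewrite leNgt ws.
Qed.

(** Rational points meet every open orthant around a given point, so a hull
    that contains them contains everything. *)
Lemma conv_hull_setT_rat A :
  conv_hull A = setT <-> forall q, conv_hull A (ratv q).
Proof.
split=> [-> //|Aq]; apply/seteqP; split=> // x _.
suff : conv_hull (conv_hull A) x.
  by apply: conv_hull_sub => //; exact: conv_hull_convex.
apply: conv_hull_orthants => s.
have [q xq] := nbhs_ratv (nbhsx_ballx (x + sgnv s) 1 ltr01).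
exists (ratv q); split=> // i; have [_ /(_ 0 i)] := xq.
rewrite /ball/= !mxE; case: (s i); rewrite ?expr0 ?expr1 ltr_norml; lra.
Qed.

(** Only rational points have to be checked. Such a point is in the hull of
    finitely many points of the configuration, and this is tested by rational
    directions, so all quantifiers are countable. *)
Lemma mpred_conv_hull_setT :
  mpred (fun eta : point_config R d => conv_hull (points eta) = setT).
Proof.
suff : mpred (fun eta : point_config R d => forall q : 'rV[rat]_d,
    exists l : seq rbox_index, (forall i, i \in l -> single_point i eta) /\
    forall w, exists i, i \in l /\ 0 <= dotp (ratv w) (point_at i eta - ratv q)).
  apply: mpred_ext => eta; rewrite conv_hull_setT_rat.
  split=> h q.
    have [l [lpt lw]] := h q.
    apply: (@conv_hull_mono _ _ [set` [seq (point_at i eta : 'rV_d) | i <- l]]).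
      by move=> _ /= /mapP[i il ->]; exact/point_at_mem/lpt.
    apply/conv_hull_ratP => w; have [i [il iw]] := lw w.
    by exists (point_at i eta) => //; exact: map_f.
  have /conv_hull_finite[s seta /conv_hull_ratP sw] := h q.
  have /choice[f fP] : forall y, exists i, y \in s -> single_point i eta /\ point_at i eta = y.
    move=> y; have [/seta/point_at_enum[i iy]|ys] := boolP (y \in s); first by exists i.
    by exists (0, 0%N).
  exists (map f s); split=> [_ /mapP[y ys ->]|w]; first by have [] := fP _ ys.
  have [y ys yw] := sw w; exists (f y); split; first exact: map_f.
  by rewrite (fP _ ys).2.
apply: mpred_all => q; apply: mpred_ex => l; apply: mpred_and.
  apply: mpred_all => i; apply: mpred_imp; first exact: mpred_cst.
  exact: mpred_single_point.
apply: mpred_all => w; apply: mpred_ex => i; apply: mpred_and; first exact: mpred_cst.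
apply: mpred_ler; first exact: measurable_cst.
apply: measurable_dotp; first exact: measurable_cst.
apply/measurable_rowP => j; under eq_fun do rewrite mxE mxE.
apply: measurable_funD; last exact: measurable_cst.
by have /measurable_rowP := @measurable_point_at R d i; exact.
Qed.

(** Both tiles touch the hyperplane in the hull of the same set of common
    vertices, so the intersection is the contact face of each. *)
Lemma face_of_separated (X Y : Defs.cluster R d) u c : u != 0 ->
  (forall x, x \in X -> dotp u x <= c) -> (forall y, y \in Y -> c <= dotp u y) ->
  (forall x, x \in X -> dotp u x = c -> x \in Y) ->
  (forall y, y \in Y -> dotp u y = c -> y \in X) ->
  let I := conv_hull [set` X] `&` conv_hull [set` Y] in
  I !=set0 -> is_face (conv_hull [set` X]) I /\ is_face (conv_hull [set` Y]) I.
Proof.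
move=> u0 Xc Yc XY YX I I0.
have Yc' y : y \in Y -> dotp (- u) y <= - c by rewrite dotpNl lerN2; exact: Yc.
have hX x : conv_hull [set` X] x -> dotp u x <= c by exact: conv_hull_le.
have hY y : conv_hull [set` Y] y -> c <= dotp u y.
  by move=> Yy; rewrite -lerN2 -dotpNl; exact: conv_hull_le Yc' _ Yy.
have HN : hyperplane (- u) (- c) = hyperplane u c.
  by apply/seteqP; split=> x; rewrite /hyperplane/= dotpNl; [move=> /oppr_inj|move=> ->].
have IX : I = hyperplane u c `&` conv_hull [set` X].
  apply/seteqP; split=> [x [Xx Yx]|x [ux Xx]]; split=> //.
    by apply/eqP; rewrite eq_le hX//= hY.
  have := conv_hull_face Xc Xx ux; apply: conv_hull_mono => y [/= yX yc].
  exact: XY.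
have IY : I = hyperplane u c `&` conv_hull [set` Y].
  apply/seteqP; split=> [x [Xx Yx]|x [ux Yx]]; split=> //.
    by apply/eqP; rewrite eq_le hX//= hY.
  have uxN : dotp (- u) x = - c by rewrite dotpNl ux.
  have := conv_hull_face Yc' Yx uxN; apply: conv_hull_mono => y [/= yY].
  by rewrite -/(hyperplane _ _ y) HN; exact: YX.
have [z Iz] := I0.
split; right; exists (hyperplane u c) => //.
  by exists u, c; split=> //; exists z; rewrite -IX.
exists (- u), (- c); split=> //; first by rewrite oppr_eq0.
  by move=> x /hY; rewrite dotpNl lerN2.
by exists z; rewrite -IY.
Qed.

(** Approximate solutions of closed inequalities in a compact set accumulate
    at an exact solution. *)
Lemma compact_limit (T : topologicalType) (K : set T) (Fs : set (T -> R)) :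
  compact K -> (forall f, Fs f -> continuous f) ->
  (forall m : nat, exists p, K p /\ forall f, Fs f -> f p <= m.+1%:R^-1) ->
  exists p, K p /\ forall f, Fs f -> f p <= 0.
Proof.
move=> cK cf /choice[p pP].
have [|z [Kz zp]] := cK (p @ \oo) _; first by exists 0%N => // m _; exact: (pP m).1.
exists z; split=> // f Ff; rewrite leNgt; apply/negP => fz.
have fz2 : 0 < f z / 2 by rewrite divr_gt0.
have [] := zp [set y | f y < f z / 2] [set y | f z / 2 < f y].
- have : \forall m \near \oo, m.+1%:R^-1 < f z / 2 by exact: (near_infty_natSinv_lt (PosNum fz2)).
  apply: filterS => m mf; exact: le_lt_trans ((pP m).2 _ Ff) mf.
- apply: (cvgr_gt (f z)); first exact: cf.
  by rewrite ltr_pdivrMr// mulr2n mulrDr mulr1 ltrDl.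
by move=> y [/= /lt_trans h /h]; rewrite ltxx.
Qed.

End hull_criteria.

(** * Countable certificates for tessellations *)

Section tessellation_certificates.
Context {R : realType} {d : nat}.
Local Notation C := (cluster_space R d).
Local Notation M := (cluster_config R d).
Implicit Types (X Y : Defs.cluster R d) (u x y : 'rV[R]_d) (c : R).

Definition l1norm u : R := \sum_i `|u 0 i|.

Lemma dotp_l1norm u x : dotp u x <= l1norm u * `|x|.
Proof.
rewrite /l1norm mulr_suml; apply: ler_sum => i _.
by rewrite (le_trans (ler_norm _))// normrM ler_wpM2l// normr_coord.
Qed.

(** A vertex is designated by a box that contains no other vertex; a rational
    hyperplane has to cut it off from the rest. *)
Definition exposed_certificate X := forall i, [set` X] `&` rbox i #= `I_1 ->
  exists (w : 'rV[rat]_d) (c : rat), [/\ ratv w != 0 :> 'rV[R]_d,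
    ~ hits (rbox i `&` [set x | dotp (ratv w) x <= ratr c]) X &
    ~ hits (~` rbox i `&` [set x | ratr c <= dotp (ratv w) x]) X].

(** For a fixed N, one K has to serve all clusters of a configuration: only
    finitely many of them have a vertex in the cube of size K, and the hulls
    of the others avoid the cube of size N. *)
Definition near_or_separated (N K : nat) X := hits (cube K%:R) X \/
  exists w : 'rV[rat]_d,
    ~ hits [set x | dotp (ratv w) x <= N%:R * l1norm (ratv w)] X.

(** The slack 1 / m.+1 allows rational hyperplanes to approach one that
    contains the common vertices. The gap 1 / n.+1, which does not depend on
    m, keeps the other vertices off the limit. Boundedness of (w, q) provides
    compactness. The last two clauses say, through boxes, that a vertex inside
    the gap is shared by the two clusters. *)
Definition separation_certificate X Y := exists n : nat, forall m : nat,
  exists (w : 'rV[rat]_d) (q : rat),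
  [/\ (forall i, `[-1, 1]%classic (ratv w 0 i : R)) /\ `[-1, 1]%classic (ratr q : R),
      ~ hits [set x | ratr q + m.+1%:R^-1 < dotp (ratv w) x] X,
      ~ hits [set y | dotp (ratv w) y < ratr q - m.+1%:R^-1] Y,
      forall i, hits (rbox i `&` [set x | ratr q - n.+1%:R^-1 < dotp (ratv w) x]) X ->
        hits (rbox i) Y &
      forall i, hits (rbox i `&` [set y | dotp (ratv w) y < ratr q + n.+1%:R^-1]) Y ->
        hits (rbox i) X].

(** Each clause is a countable combination of counting events. *)
Definition certified (mu : M) :=
  [/\ forall X, clusters mu X -> exposed_certificate X,
      forall N, exists K, forall X, clusters mu X -> near_or_separated N K X,
      forall i j, single_cluster i mu -> single_cluster j mu ->
        separation_certificate (cluster_at i mu) (cluster_at j mu) &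
      forall q, exists X, clusters mu X /\ conv_hull [set` X] (ratv q)].

Let V := borel_space R d.

Let mle (u : V) c : measurable ([set x | dotp u x <= c] : set V).
Proof. exact: mpred_ler (borel_dotp u) (@measurable_cst _ _ V _ setT c). Qed.

Let mge (u : V) c : measurable ([set x | c <= dotp u x] : set V).
Proof. exact: mpred_ler (@measurable_cst _ _ V _ setT c) (borel_dotp u). Qed.

Let mlt (u : V) c : measurable ([set x | dotp u x < c] : set V).
Proof. exact: mpred_ltr (borel_dotp u) (@measurable_cst _ _ V _ setT c). Qed.

Let mgt (u : V) c : measurable ([set x | c < dotp u x] : set V).
Proof. exact: mpred_ltr (@measurable_cst _ _ V _ setT c) (borel_dotp u). Qed.

Let mbx i : measurable (rbox i : set V).
Proof. exact: rbox_borel. Qed.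

Lemma mpred_exposed : mpred (exposed_certificate : C -> Prop).
Proof.
apply: mpred_all => i; apply: mpred_imp.
  by apply: mpred_cluster_count; exact: bounded_borel_rbox.
apply: mpred_ex => w; apply: mpred_ex => c.
have m1 : mpred (fun X : C => ~ hits (rbox i `&` [set x | dotp (ratv w) x <= ratr c]) X).
  by apply: mpred_not; apply: mpred_hits; apply: measurableI.
have m2 : mpred (fun X : C => ~ hits (~` rbox i `&` [set x | ratr c <= dotp (ratv w) x]) X).
  apply: mpred_not; apply: mpred_hits; apply: measurableI => //.
  by apply: measurableC.
have := mpred_and (mpred_cst (ratv w != 0 :> 'rV[R]_d)) (mpred_and m1 m2).
by apply: mpred_ext => X; split=> [[? []]|[]].
Qed.

Lemma mpred_near_or_separated N K : mpred (near_or_separated N K : C -> Prop).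
Proof.
apply: mpred_or; first by apply: mpred_hits; exact: cube_borel.
by apply: mpred_ex => w; apply: mpred_not; exact: mpred_hits.
Qed.

Lemma mpred_conv_hull_cluster x : mpred (fun X : C => conv_hull [set` X] x).
Proof.
suff : mpred (fun X : C => forall w, hits [set y | dotp (ratv w) x <= dotp (ratv w) y] X).
  apply: mpred_ext => X; rewrite (conv_hull_ratP (enum_fset X)).
  split=> h w; have [y yX yw] := h w; exists y => //; move: yw.
    by rewrite dotpBr subr_ge0.
  by rewrite dotpBr subr_ge0.
by apply: mpred_all => w; apply: mpred_hits.
Qed.

Lemma mpred_separation disp (T : measurableType disp) (f g : T -> C) :
  measurable_fun setT f -> measurable_fun setT g ->
  mpred (fun t => separation_certificate (f t) (g t)).
Proof.
move=> mf mg; apply: mpred_ex => n; apply: mpred_all => m.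
apply: mpred_ex => w; apply: mpred_ex => q.
have mh (h : T -> C) A : measurable_fun setT h -> measurable (A : set V) ->
    mpred (fun t => hits A (h t)).
  by move=> mh mA; exact: mpred_comp mh (mpred_hits mA).
have m1 := mpred_not (mh f _ mf (mgt (ratv w) (ratr q + m.+1%:R^-1))).
have m2 := mpred_not (mh g _ mg (mlt (ratv w) (ratr q - m.+1%:R^-1))).
have m3 : mpred (fun t => forall i,
    hits (rbox i `&` [set x | ratr q - n.+1%:R^-1 < dotp (ratv w) x]) (f t) ->
    hits (rbox i) (g t)).
  by apply: mpred_all => i; apply: mpred_imp; apply: mh => //; apply: measurableI.
have m4 : mpred (fun t => forall i,
    hits (rbox i `&` [set x | dotp (ratv w) x < ratr q + n.+1%:R^-1]) (g t) ->
    hits (rbox i) (f t)).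
  by apply: mpred_all => i; apply: mpred_imp; apply: mh => //; apply: measurableI.
have := mpred_and (mpred_cst ((forall i, `[-1, 1]%classic (ratv w 0 i : R)) /\
  `[-1, 1]%classic (ratr q : R))) (mpred_and m1 (mpred_and m2 (mpred_and m3 m4))).
by apply: mpred_ext => X; split=> [[? [? [? []]]]|[]].
Qed.

Lemma mpred_certified : mpred certified.
Proof.
have m1 : mpred (fun mu : M => forall X, clusters mu X -> exposed_certificate X).
  exact: mpred_all_clusters mpred_exposed.
have m2 : mpred (fun mu : M => forall N, exists K, forall X, clusters mu X ->
    near_or_separated N K X).
  apply: mpred_all => N; apply: mpred_ex => K.
  exact: mpred_all_clusters (mpred_near_or_separated N K).
have m3 : mpred (fun mu : M => forall i j, single_cluster i mu -> single_cluster j mu ->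
    separation_certificate (cluster_at i mu) (cluster_at j mu)).
  apply: mpred_all => i; apply: mpred_all => j.
  apply: mpred_imp; first exact: mpred_single_cluster.
  apply: mpred_imp; first exact: mpred_single_cluster.
  by apply: mpred_separation; exact: measurable_cluster_at.
have m4 : mpred (fun mu : M => forall q, exists X, clusters mu X /\ conv_hull [set` X] (ratv q)).
  by apply: mpred_all => q; apply: mpred_ex_cluster; exact: mpred_conv_hull_cluster.
have := mpred_and m1 (mpred_and m2 (mpred_and m3 m4)).
by apply: mpred_ext => X; split=> [[? [? []]]|[]].
Qed.

Lemma cluster_isolating_box X a : a \in X -> exists i, [set` X] `&` rbox i = [set a].
Proof.
move=> aX; have [e e0 ae] := finite_isolated a (finite_fset X).
have [i [ai ie]] := rbox_basis a e0; exists i; apply/seteqP; split=> [y [yX /ie]|_ ->//].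
exact: ae.
Qed.

Lemma conv_hull_nonempty (A : set 'rV[R]_d) x : conv_hull A x -> A !=set0.
Proof.
move=> Ax; apply/set0P/eqP => A0; move: Ax; rewrite A0.
by apply: conv_hull_sub => //; apply/convexP.
Qed.

Lemma missing_box X a : a \notin X -> exists i, rbox i a /\ ~ hits (rbox i) X.
Proof.
move=> aX; have [e e0 ae] := finite_isolated a (finite_fset X).
have [i [ai ie]] := rbox_basis a e0; exists i; split=> // -[y yX /ie] /(ae y yX) ya.
by move: aX; rewrite -ya yX.
Qed.

Lemma exposed_discrete_polytope X : exposed_certificate X -> discrete_polytope X.
Proof.
move=> eX a aX; have [i Xi] := cluster_isolating_box aX.
have [|w [c [w0 Xin Xout]]] := eX i; first by apply/card_eq1P; exists a.
set u : 'rV[R]_d := ratv w in w0 Xin Xout.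
have ai : rbox i a by have /seteqP[_ /(_ a erefl)[]] := Xi.
have ca : ratr c < dotp u a.
  by rewrite ltNge; apply/negP => uac; apply: Xin; exists a.
have xc x : x \in X -> x != a -> dotp u x < ratr c.
  move=> xX xa; rewrite ltNge; apply/negP => cx; apply: Xout; exists x => //.
  split=> //= ix; have /seteqP[/(_ x) + _] := Xi.
  by move=> /(_ (conj xX ix))/eqP; exact/negP.
have xa x : [set` X] x -> dotp u x <= dotp u a.
  move=> xX; have [->//|/(xc x xX) h] := eqVneq x a.
  exact: ltW (lt_trans h ca).
exists (hyperplane u (dotp u a)).
  exists u, (dotp u a); split=> //; first exact: conv_hull_le.
  by exists a; split=> //; exact: sub_conv_hull.
apply/seteqP; split=> [x [ux Xx]|_ ->]; last by split=> //; exact: sub_conv_hull.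
have := conv_hull_face xa Xx ux; apply: conv_hull_sub => [|y [/= yX]].
  by apply/convexP => y z t -> -> _ _; rewrite -scalerDl addrC subrK scale1r.
rewrite /hyperplane/= => uy; apply/eqP; apply: contraT => /(xc y yX).
by rewrite uy => /(lt_trans ca); rewrite ltxx.
Qed.

(** The l1 norm bounds the linear form on a cube of the sup norm, so a
    separated cluster has a hull that misses the cube. *)
Lemma certified_locally_finite (mu : M) :
  (forall N, exists K, forall X, clusters mu X -> near_or_separated N K X) ->
  forall B : set 'rV[R]_d, bounded_set B ->
  finite_set [set X | clusters mu X /\ conv_hull [set` X] `&` B !=set0].
Proof.
move=> far B [r [_ Br]].
pose N := Num.bound (`|r| + 1).
have [K XK] := far N.
apply: sub_finite_set (clusters_lfin mu (cube_bounded K%:R)).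
move=> X [muX [y [Xy By]]]; split=> //.
have [[x xX xK]|[w Xw]] := XK _ muX; first by exists x.
exfalso; have yN : `|y| <= N%:R.
  have := Br (`|r| + 1) _ y By; rewrite (le_lt_trans (ler_norm r)) ?ltrDl//.
  move=> /(_ isT)/le_trans; apply.
  by apply: ltW; rewrite archi_boundP// addr_ge0.
have : dotp (- ratv w) y < - (N%:R * l1norm (ratv w)).
  apply: conv_hull_lt Xy => x xX; rewrite dotpNl ltrN2 ltNge.
  by apply/negP => h; apply: Xw; exists x.
rewrite dotpNl ltrN2; apply/negP; rewrite -leNgt mulrC.
apply: le_trans (dotp_l1norm _ _) _; rewrite ler_wpM2l//.
exact: sumr_ge0.
Qed.

(** By local finiteness a point outside all hulls has a neighbourhood outside
    all hulls, and this would contain a rational point. *)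
Lemma certified_complete (mu : M) :
  (forall B : set 'rV[R]_d, bounded_set B ->
    finite_set [set X | clusters mu X /\ conv_hull [set` X] `&` B !=set0]) ->
  (forall q, exists X, clusters mu X /\ conv_hull [set` X] (ratv q)) ->
  complete mu.
Proof.
move=> lf cov; apply/seteqP; split=> // x _; apply: contrapT => nx.
have fin := lf _ (cube_bounded (`|x| + 1)).
have : \forall y \near x, forall X,
    [set X | clusters mu X /\ conv_hull [set` X] `&` cube (`|x| + 1) !=set0] X ->
    ~ conv_hull [set` X] y.
  apply: (near_finite (F := nbhs x) (Q := fun X y => ~ conv_hull [set` X] y)) => //.
  move=> X [muX _]; have /(finite_separation (s := enum_fset X))[u uX] : ~ conv_hull [set` X] x.
    by move=> Xx; apply: nx; exists X.
  have : \forall y \near x, forall z, [set` X] z -> dotp u z < dotp u y.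
    apply: (near_finite (F := nbhs x) (Q := fun z y => dotp u z < dotp u y)) => // z zX.
    under eq_near do rewrite [ltRHS]dotpC.
    apply: (cvgr_gt (dotp x u)); first exact: continuous_dotp.
    by rewrite [ltRHS]dotpC; exact: uX.
  by apply: filterS => y Xy /(conv_hull_lt Xy); rewrite ltxx.
move=> xn; have [q [xq nq]] := nbhs_ratv (filterI (nbhsx_ballx x 1 ltr01) xn).
have [X [muX Xq]] := cov q; apply: (nq X _ Xq); split=> //.
by exists (ratv q); split=> //; rewrite /cube/=; exact: norm_le_ball xq.
Qed.

(** Both clusters must be nonempty: against an empty cluster the certificate
    holds with u = 0 and c > 0. When the limit normal u vanishes, so does c,
    and then all vertices are shared. *)
Lemma separation_certificateP X Y : [set` X] !=set0 -> [set` Y] !=set0 ->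
  separation_certificate X Y ->
  X = Y \/ exists u c, [/\ u != 0,
    (forall x, x \in X -> dotp u x <= c), (forall y, y \in Y -> c <= dotp u y),
    (forall x, x \in X -> dotp u x = c -> x \in Y) &
    (forall y, y \in Y -> dotp u y = c -> y \in X)].
Proof.
move=> [x0 x0X] [y0 y0Y] [n sep]; set e : R := n.+1%:R^-1.
pose K := [set v : 'rV[R]_d | forall i, `[-1, 1]%classic (v 0 i)] `*` `[-1, 1 : R]%classic.
pose g x := fun p : 'rV[R]_d * R => dotp p.1 x - p.2.
pose F1 := [set f | exists x, x \in X /\ f = g x].
pose F2 := [set f | exists y, y \in Y /\ f = fun p => - g y p].
pose F3 := [set f | exists x, (x \in X /\ x \notin Y) /\
  f = fun p => g x p + e].
pose F4 := [set f | exists y, (y \in Y /\ y \notin X) /\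
  f = fun p => - g y p + e].
have cK : compact K.
  apply: compact_setX; last exact: segment_compact.
  by apply: (@rV_compact R _ (fun=> `[-1, 1]%classic)) => _; exact: segment_compact.
have Fcont f : (F1 `|` F2 `|` F3 `|` F4) f -> continuous f.
  have cN (h : 'rV[R]_d * R -> R) : continuous h -> continuous (fun p => - h p).
    by move=> cg p; exact: cvgN (cg p).
  have cD (h : 'rV[R]_d * R -> R) : continuous h -> continuous (fun p => h p + e).
    by move=> cg p; exact: cvgD (cg p) (cvg_cst e).
  move=> [[[|]|]|] [z [_ ->]].
  - exact: continuous_dotp_sub.
  - by apply: cN; exact: continuous_dotp_sub.
  - by apply: cD; exact: continuous_dotp_sub.
  - by apply: cD; apply: cN; exact: continuous_dotp_sub.
have [|[u c] [_ uc]] := compact_limit cK Fcont.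
  move=> m; have [w [q [wq X1 Y1 X2 Y2]]] := sep m.
  exists (ratv w, ratr q); split; first by [].
  have m0 : 0 <= m.+1%:R^-1 :> R by rewrite invr_ge0.
  move=> f [[[[x [xX ->]]|[y [yY ->]]]|[x [[xX xY] ->]]]|[y [[yY yX] ->]]] /=.
  - rewrite lerBlDl leNgt; apply/negP => h; apply: X1; exists x => //.
  - rewrite opprB lerBlDr -lerBlDl leNgt; apply/negP => h; apply: Y1; exists y => //.
  - apply: le_trans m0; rewrite -lerBrDr sub0r lerBlDr addrC leNgt; apply/negP => h.
    have [i [ix Yi]] := missing_box xY.
    by apply: Yi; apply: X2; exists x.
  - apply: le_trans m0; rewrite opprB addrAC subr_le0 leNgt; apply/negP => h.
    have [i [iy Xi]] := missing_box yX.
    by apply: Xi; apply: Y2; exists y.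
have Xc x : x \in X -> dotp u x <= c.
  by move=> xX; rewrite -subr_le0; apply: (uc (g x)); left; left; left; exists x.
have Yc y : y \in Y -> c <= dotp u y.
  move=> yY; rewrite -subr_ge0 -oppr_le0.
  by apply: (uc (fun p => - g y p)); left; left; right; exists y.
(* a vertex that is not shared stays at distance e from the limit hyperplane
   *)
have e0 : 0 < e by rewrite invr_gt0.
have XY x : x \in X -> dotp u x = c -> x \in Y.
  move=> xX xc; apply: contraT => xY.
  have : dotp u x - c + e <= 0 by apply: (uc (fun p => g x p + e)); left; right; exists x.
  by rewrite xc subrr add0r leNgt e0.
have YX y : y \in Y -> dotp u y = c -> y \in X.
  move=> yY yc; apply: contraT => yX.
  have : - (dotp u y - c) + e <= 0 by apply: (uc (fun p => - g y p + e)); right; exists y.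
  by rewrite yc subrr oppr0 add0r leNgt e0.
have [u0|un0] := eqVneq u 0; last by right; exists u, c.
have c0 : c = 0.
  apply/eqP; rewrite eq_le; have := Yc _ y0Y; have := Xc _ x0X.
  by rewrite u0 !dotp0l => -> ->.
left; apply/fsetP => z; apply/idP/idP => [zX|zY].
  by apply: XY => //; rewrite u0 dotp0l.
by apply: YX => //; rewrite u0 dotp0l.
Qed.

Lemma certified_tessellation (mu : M) :
  certified mu -> cluster_tessellation mu /\ complete mu.
Proof.
move=> [exp far sep cov]; have lf := certified_locally_finite far.
split; last exact: certified_complete.
split=> // [X /exp|X Y]; first exact: exposed_discrete_polytope.
move=> /cluster_at_enum[i [imu <-]] /cluster_at_enum[j [jmu <-]] I I0.
have [z [/conv_hull_nonempty X0 /conv_hull_nonempty Y0]] := I0.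
have [XY|[u [c [u0 Xc Yc XY YX]]]] := separation_certificateP X0 Y0 (sep i j imu jmu).
  by rewrite /I XY setIid; split; left.
exact: (face_of_separated u0 Xc Yc XY YX).
Qed.

End tessellation_certificates.

(** * Voronoi cells *)

Section linear_algebra.
Context {F : fieldType} {d : nat}.

(** A vector w orthogonal to the rows of M detects that y is not a combination
    of them. *)
Lemma row_free_extend k (M : 'M[F]_(k, d)) (y w : 'rV[F]_d) :
  row_free M -> M *m w^T = 0 -> y *m w^T != 0 -> row_free (col_mx y M).
Proof.
move=> Mfree Mw yw; rewrite -kermx_eq0; apply/rowV0P => z.
rewrite sub_kermx -[z]hsubmxK mul_row_col => /eqP zM.
have zl : lsubmx z = 0.
  have := congr1 (mulmx^~ w^T) zM; rewrite mulmxDl -!mulmxA Mw mulmx0 addr0 mul0mx.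
  rewrite [lsubmx z]mx11_scalar mul_scalar_mx => /eqP.
  by rewrite scaler_eq0 (negPf yw) orbF => /eqP ->; rewrite raddf0.
have zr : rsubmx z = 0.
  apply/eqP; rewrite -(mulmx_free_eq0 _ Mfree).
  by move: zM; rewrite zl mul0mx add0r => ->.
by rewrite zl zr row_mx0.
Qed.

Lemma exists_orthogonal k (M : 'M[F]_(k, d)) : (k < d)%N ->
  exists2 w : 'rV[F]_d, w != 0 & M *m w^T = 0.
Proof.
move=> kd; have ker0 : kermx M^T != 0.
  rewrite kermx_eq0 /row_free mxrank_tr; apply/eqP => rM.
  by have := rank_leq_row M; rewrite rM leqNgt kd.
exists (nz_row (kermx M^T)); first by rewrite nz_row_eq0.
apply: trmx_inj; rewrite trmx_mul trmxK trmx0; apply/eqP.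
by rewrite -sub_kermx nz_row_sub.
Qed.

End linear_algebra.

Section voronoi.
Context {R : realType} {d : nat}.
Implicit Types (u v w x y a b : 'rV[R]_d) (c t r : R) (eta : point_set R d).

Lemma mulmx_tr_dotp k (M : 'M[R]_(k, d)) w i : (M *m w^T) i 0 = dotp (row i M) w.
Proof. by rewrite mxE; apply: eq_bigr => j _; rewrite !mxE. Qed.

Lemma dotp_mx u w : u *m w^T = (dotp u w)%:M.
Proof. by rewrite [LHS]mx11_scalar mulmx_tr_dotp row_id. Qed.

(** The difference of the squared distances from v to a and to b. It is affine
    in v, and v belongs to the cell of a when it is nonpositive for all b. *)
Definition power_gap a b v : R := 2 * dotp v (b - a) - (dotp b b - dotp a a).

Lemma edist_power_gap a b v : (Defs.edist v a <= Defs.edist v b) = (power_gap a b v <= 0).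
Proof.
rewrite /Defs.edist ler_psqrt ?nnegrE ?dotp_ge0// !dotpBB /power_gap dotpBr.
by rewrite -subr_le0; congr (_ <= _); ring.
Qed.

Lemma power_gap_le0 a b v : (power_gap a b v <= 0) = (0 <= power_gap b a v).
Proof. by rewrite -oppr_ge0 /power_gap !dotpBr; congr (_ <= _); ring. Qed.

Lemma power_gapC a b v : power_gap b a v = - power_gap a b v.
Proof. by rewrite /power_gap !dotpBr; ring. Qed.

(** This cocycle relation compares the cells of a and of b at a point of their
    bisector. *)
Lemma power_gapD a b b' v : power_gap a b' v = power_gap a b v + power_gap b b' v.
Proof. by rewrite /power_gap !dotpBr; ring. Qed.

Lemma power_gap_line a b v w t :
  power_gap a b (v + t *: w) = power_gap a b v + 2 * t * dotp w (b - a).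
Proof. by rewrite /power_gap dotpDl dotpZl; ring. Qed.

Lemma voronoi_cellE (eta : set 'rV[R]_d) a v :
  voronoi_cell eta a v <-> forall b, eta b -> power_gap a b v <= 0.
Proof. by split=> h b /h; rewrite edist_power_gap. Qed.

Lemma voronoi_cell_convex (eta : set 'rV[R]_d) a : convex_set (voronoi_cell eta a).
Proof.
apply/convexP => x y t /voronoi_cellE ax /voronoi_cellE ay t0 t1.
apply/voronoi_cellE => b etab.
have := ax b etab; have := ay b etab; rewrite /power_gap !subr_le0 => yb xb.
have /convexP := @convex_le R d (2 *: (b - a)) (dotp b b - dotp a a).
move=> /(_ x y t) /=; rewrite !(dotpC (_ *: _)) !dotpZr.
by apply.
Qed.

(** Together with local finiteness, this bound leaves only finitely many
    points that compete with a near a given bounded set. *)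
Lemma gap_bound a r0 : exists r, forall x b, `|x| <= r0 -> 0 <= power_gap a b x -> `|b| <= r.
Proof.
exists (r0 + Num.sqrt (d%:R * (r0 + `|a|) ^+ 2)) => x b xr.
rewrite -power_gap_le0 -edist_power_gap => xba.
rewrite (_ : b = x - (x - b)); last by rewrite subKr.
rewrite (le_trans (ler_normB _ _))// lerD// (le_trans (normr_le_edist _ _))//.
rewrite (le_trans xba)// (le_trans (edist_le_normr _ _))//.
rewrite ler_wsqrtr// ler_wpM2l// lerXn2r ?nnegrE//.
  by rewrite addr_ge0// (le_trans _ xr).
by rewrite (le_trans (ler_normB _ _))// lerD2r.
Qed.

(** The directions that are tangent to all the constraints active at v. *)
Definition neutral (eta : set 'rV[R]_d) a v w :=
  forall b, eta b -> power_gap a b v = 0 -> dotp w (b - a) = 0.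

(** Active constraints are constant along w, the finitely many inactive ones
    that matter stay strict for small t. *)
Lemma voronoi_slack eta a v w : voronoi_cell eta a v -> neutral eta a v w ->
  \forall t \near (0 : R), voronoi_cell eta a (v + t *: w).
Proof.
move=> /voronoi_cellE va vw; have [r rb] := gap_bound a (`|v| + `|w|).
have near1 : \forall t \near (0 : R), `|t| <= 1.
  by apply: filterS (nbhsx_ballx (0 : R) 1 ltr01) => t; rewrite /ball/= sub0r normrN => /ltW.
have nearK : \forall t \near (0 : R), forall b, (points eta `&` cube r) b ->
    power_gap a b (v + t *: w) <= 0.
  apply: (near_finite (F := nbhs (0 : R)) (Q := fun b t => power_gap a b (v + t *: w) <= 0)).
    exact: points_lfin (cube_bounded r).
  move=> b [etab _]; have := va b etab; rewrite le_eqVlt => /orP[/eqP vb|vb].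
    by near=> t; rewrite power_gap_line vb (vw b etab vb) mulr0 addr0.
  have : (power_gap a b v + 2 * t * dotp w (b - a)) @[t --> (0 : R)] -->
      power_gap a b v + 2 * 0 * dotp w (b - a).
    apply: cvgD; first exact: cvg_cst.
    by apply: cvgMr_tmp; apply: cvgMl_tmp; exact: cvg_id.
  rewrite mulr0 mul0r addr0 => /cvgr_lt/(_ _ vb).
  by apply: filterS => t /ltW; rewrite power_gap_line.
near=> t; apply/voronoi_cellE => b etab.
have t1 : `|t| <= 1 by near: t.
have tK : forall b, (points eta `&` cube r) b -> power_gap a b (v + t *: w) <= 0 by near: t.
rewrite leNgt; apply/negP => h.
suff bK : (points eta `&` cube r) b by have := tK b bK; rewrite leNgt h.
split=> //.
apply: rb (ltW h); rewrite (le_trans (ler_normD _ _))// lerD2l normrZ ler_piMl//.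
Unshelve. all: by end_near. Qed.

Lemma voronoi_slack_pos eta a v w : voronoi_cell eta a v -> neutral eta a v w ->
  exists2 t, 0 < t & voronoi_cell eta a (v + t *: w).
Proof.
move=> va vw; have h : \forall t \near (0 : R)^'+, voronoi_cell eta a (v + t *: w).
  by apply: (cvg_at_right_filter cvg_id); exact: voronoi_slack.
by near (0 : R)^'+ => t; exists t; [|near: t].
Unshelve. all: by end_near. Qed.

(** The directions p - a along which the cell is bounded above form a convex
    set of points p, and it contains the whole configuration; hence it
    contains a plus or minus each basis vector. *)
Lemma voronoi_bounded eta a : conv_hull eta = setT -> points eta a ->
  exists r, forall v, voronoi_cell eta a v -> `|v| <= r.
Proof.
move=> hull etaa.
pose B := [set p | exists c, forall v, voronoi_cell eta a v -> dotp (v - a) (p - a) <= c].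
(* for p in the configuration, half the squared length of p - a is a bound *)
have BT p : B p.
  suff : conv_hull eta `<=` B by rewrite hull => /(_ p); apply.
  apply: conv_hull_sub => [|b etab].
    apply/convexP => x y t [cx xc] [cy yc] t0 t1.
    exists (t * cx + (1 - t) * cy) => v va.
    have -> : t *: x + (1 - t) *: y - a = t *: (x - a) + (1 - t) *: (y - a).
      by apply/rowP => j; rewrite !mxE; ring.
    by rewrite dotpDr !dotpZr lerD// ler_wpM2l ?subr_ge0// ?xc ?yc.
  exists (dotp (b - a) (b - a) / 2) => v /voronoi_cellE/(_ b etab).
  by rewrite /power_gap ler_pdivlMr// !dotpBr !dotpBl (dotpC a b); lra.
have /choice[c1 c1P] : forall i, exists c, forall v, voronoi_cell eta a v -> v 0 i - a 0 i <= c.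
  move=> i; have [c cP] := BT (a + delta_mx 0 i); exists c => v /cP.
  by rewrite addrAC subrr add0r dotp_delta !mxE.
have /choice[c2 c2P] : forall i, exists c, forall v, voronoi_cell eta a v -> a 0 i - v 0 i <= c.
  move=> i; have [c cP] := BT (a - delta_mx 0 i); exists c => v /cP.
  by rewrite addrAC subrr add0r dotpNr dotp_delta !mxE opprB.
exists (`|a| + \sum_i (`|c1 i| + `|c2 i|)) => v va.
rewrite -[v](subrK a) addrC (le_trans (ler_normD _ _))// lerD2l.
rewrite [leLHS]/Num.norm/= mx_normrE; apply/bigmax_leP; split=> [|[i j] _ /=].
  by apply: sumr_ge0 => i _; rewrite addr_ge0.
rewrite ord1 (bigD1 j)//= !mxE ler_wpDr//; first by apply: sumr_ge0 => k _; rewrite addr_ge0.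
have := c1P j v va; have := c2P j v va; have := ler_norm (c1 j); have := ler_norm (c2 j).
have := normr_ge0 (c1 j); have := normr_ge0 (c2 j).
by rewrite ler_norml; lra.
Qed.

(** The exit time is the supremum of the times spent in the cell. A neutral
    direction at the exit point could be followed further, so a new constraint
    is active there. *)
Lemma voronoi_exit eta a v w r : (forall v, voronoi_cell eta a v -> `|v| <= r) ->
  voronoi_cell eta a v -> w != 0 -> neutral eta a v w ->
  exists t, [/\ 0 < t, voronoi_cell eta a (v + t *: w) &
    exists b, [/\ points eta b, power_gap a b (v + t *: w) = 0 & dotp w (b - a) != 0]].
Proof.
move=> bnd va w0 vw.
pose T := [set t | 0 <= t /\ voronoi_cell eta a (v + t *: w)].
have T0 : T 0 by split=> //; rewrite scale0r addr0.
have wn0 : 0 < `|w| by rewrite normr_gt0.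
have Tub : has_sup T.
  split; first by exists 0.
  exists ((r + `|v|) / `|w|) => t [t0 /bnd tr].
  rewrite ler_pdivlMr// -{1}(ger0_norm t0) -normrZ.
  rewrite (_ : t *: w = (v + t *: w) - v); last by rewrite addrAC subrr add0r.
  by rewrite (le_trans (ler_normB _ _))// lerD2r.
have sT : T (sup T).
  have s0 : 0 <= sup T by apply: ub_le_sup => //; case: Tub.
  split=> //; apply/voronoi_cellE => b etab; rewrite power_gap_line.
  move/voronoi_cellE : (va) => /(_ b etab) vb.
  have [D0|D0] := leP (dotp w (b - a)) 0.
    by have := mulr_ge0_le0 s0 D0; lra.
  have : sup T <= - power_gap a b v / (2 * dotp w (b - a)).
    apply: sup_le_ub; first by exists 0.
    move=> t [t0 /voronoi_cellE/(_ b etab)]; rewrite power_gap_line => h.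
    by rewrite ler_pdivlMr ?mulr_gt0//; lra.
  by rewrite ler_pdivlMr ?mulr_gt0//; lra.
have sub t : T t -> t <= sup T by move=> Tt; apply: ub_le_sup => //; case: Tub.
exists (sup T); split.
- have [t t0 ta] := voronoi_slack_pos va vw; apply: (lt_le_trans t0).
  by apply: sub; split; first exact: ltW.
- by case: sT.
apply: contrapT => nb.
have [|t t0] := voronoi_slack_pos (w := w) sT.2.
  by move=> b etab bs; apply/eqP/negPn/negP => h; apply: nb; exists b.
rewrite -addrA -scalerDl => h; have /sub : T (sup T + t).
  by split; first by rewrite addr_ge0 ?(ltW t0)//; case: sT.
by rewrite gerDl leNgt t0.
Qed.

End voronoi.

(** * Voronoi vertices *)

Section voronoi_vertices.
Context {R : realType} {d : nat}.
Implicit Types (u v w x y a b : 'rV[R]_d) (c t r : R) (eta : point_set R d).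

Lemma power_gapB a b x v :
  power_gap a b x - power_gap a b v = 2 * dotp (x - v) (b - a).
Proof. by rewrite /power_gap dotpBl; ring. Qed.

Lemma dotp_suml (I : Type) (s : seq I) (f : I -> 'rV[R]_d) x :
  dotp (\sum_(i <- s) f i) x = \sum_(i <- s) dotp (f i) x.
Proof.
by elim: s => [|i s ih]; rewrite ?big_nil ?dotp0l// !big_cons dotpDl ih.
Qed.

Lemma finite_active eta a v :
  finite_set [set b | points eta b /\ power_gap a b v = 0].
Proof.
have [r rb] := gap_bound a `|v|.
apply: sub_finite_set (points_lfin eta (cube_bounded r)) => b [etab vb].
by split=> //; apply: rb (lexx _) _; rewrite vb.
Qed.

(** A neutral w can be followed in both directions, so it is parallel to any
    supporting hyperplane that touches the cell only at v. Conversely, the sum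
    of the active normals exposes v, since a point of the cell that maximizes
    it satisfies all active constraints with equality. *)
Lemma voronoi_vertexP eta a v : (0 < d)%N ->
  vertices (voronoi_cell eta a) v <->
  voronoi_cell eta a v /\ forall w, neutral eta a v w -> w = 0.
Proof.
move=> d0; split.
  move=> [_ [u [c [u0 -> uc _]]] Hv].
  have [vu va] : (hyperplane u c `&` voronoi_cell eta a) v by rewrite Hv.
  split=> // w vw.
  have [t t0 vt] := voronoi_slack_pos va vw.
  have [s s0 vs] : exists2 t, 0 < t & voronoi_cell eta a (v + t *: (- w)).
    apply: voronoi_slack_pos => // b etab vb.
    by rewrite dotpNl (vw b)// oppr0.
  have uw : dotp u w = 0.
    have := uc _ vt; have := uc _ vs.
    rewrite !dotpDr !dotpZr dotpNr vu !gerDl pmulr_rle0// pmulr_rle0// => h1 h2.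
    by apply/eqP; rewrite eq_le h2 -oppr_le0.
  have : (hyperplane u c `&` voronoi_cell eta a) (v + t *: w).
    by split=> //; rewrite /hyperplane/= dotpDr dotpZr uw mulr0 addr0.
  rewrite Hv => /eqP; rewrite -subr_eq0 addrAC subrr add0r scaler_eq0 gt_eqF//=.
  by move/eqP.
move=> [va v0]; pose F := fset_set [set b | points eta b /\ power_gap a b v = 0].
have FP b : b \in F <-> points eta b /\ power_gap a b v = 0.
  by rewrite in_fset_set ?inE//; exact: finite_active.
pose u := \sum_(b <- F) (b - a).
have term x b : voronoi_cell eta a x -> b \in F -> dotp (b - a) (x - v) <= 0.
  move=> /voronoi_cellE xa /FP[etab vb]; have := power_gapB a b x v.
  by rewrite vb subr0 (dotpC (x - v)) => e; have := xa b etab; rewrite e pmulr_rle0.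
have ux x : voronoi_cell eta a x -> dotp u x <= dotp u v.
  move=> xa; rewrite -subr_le0 -dotpBr dotp_suml big_seq.
  by apply: sumr_le0 => b; exact: term.
have ueq x : voronoi_cell eta a x -> dotp u x = dotp u v -> x = v.
  move=> xa /eqP; rewrite -subr_eq0 -dotpBr dotp_suml -oppr_eq0 -sumrN big_seq_cond.
  rewrite psumr_eq0 => [/allP s0|b /andP[bF _]]; last by rewrite oppr_ge0 term.
  apply/eqP; rewrite -subr_eq0; apply/eqP; apply: v0 => b etab vb.
  have bF : b \in F by apply/FP.
  by have := s0 b bF; rewrite bF/= oppr_eq0 dotpC => /eqP.
(* if the normals cancel out, the cell is the point v and any hyperplane
   through v exposes it *)
have [u0|un0] := eqVneq u 0.
  pose e : 'rV[R]_d := const_mx 1.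
  have e0 : e != 0.
    apply/eqP => /matrixP/(_ 0 (Ordinal d0)); rewrite !mxE => /eqP.
    by rewrite oner_eq0.
  have xv x : voronoi_cell eta a x -> x = v by move=> xa; apply: ueq; rewrite // u0 !dotp0l.
  exists (hyperplane e (dotp e v)).
    by exists e, (dotp e v); split=> // [x /xv -> //|]; exists v.
  by apply/seteqP; split=> [x [_ /xv]|_ ->].
exists (hyperplane u (dotp u v)).
  by exists u, (dotp u v); split=> //; exists v.
by apply/seteqP; split=> [x [xu xa]|_ -> //]; exact: ueq.
Qed.

Definition active_rows eta a v k (M : 'M[R]_(k, d)) := forall i,
  exists b, [/\ points eta b, power_gap a b v = 0 & row i M = b - a].

Lemma active_rows_extend eta a v k (M : 'M[R]_(k, d)) b :
  active_rows eta a v M -> points eta b -> power_gap a b v = 0 ->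
  active_rows eta a v (col_mx (b - a) M).
Proof.
move=> aM etab vb i; rewrite -(fintype.splitK i); case: (fintype.split i) => j /=.
  by exists b; rewrite rowKu row_id.
by have [b' [? ? ?]] := aM j; exists b'; rewrite rowKd.
Qed.

Lemma active_rows_line eta a v w t k (M : 'M[R]_(k, d)) :
  active_rows eta a v M -> M *m w^T = 0 -> active_rows eta a (v + t *: w) M.
Proof.
move=> aM Mw i; have [b [etab vb Mb]] := aM i; exists b; split=> //.
rewrite power_gap_line vb add0r -Mb dotpC -mulmx_tr_dotp Mw mxE mulr0//.
Qed.

Lemma neutral_active_rows eta a v w k (M : 'M[R]_(k, d)) :
  active_rows eta a v M -> neutral eta a v w -> M *m w^T = 0.
Proof.
move=> aM vw; apply/matrixP => i j; rewrite ord1 mulmx_tr_dotp mxE.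
by have [b [etab vb ->]] := aM i; rewrite dotpC vw.
Qed.

(** If v is not a vertex, moving along a neutral direction both ways until the
    cell is left puts v on a segment whose ends have one more independent
    active normal; the codimension of the active normals decreases. *)
Lemma voronoi_sub_hull eta a r : (0 < d)%N -> (forall v, voronoi_cell eta a v -> `|v| <= r) ->
  voronoi_cell eta a `<=` conv_hull (vertices (voronoi_cell eta a)).
Proof.
move=> d0 bnd v va.
(* n is the number of independent active normals still missing *)
suff gen : forall n k (M : 'M[R]_(k, d)) v, (k + n = d)%N -> row_free M ->
    voronoi_cell eta a v -> active_rows eta a v M ->
    conv_hull (vertices (voronoi_cell eta a)) v.
  have M0 : row_free (0 : 'M[R]_(0, d)) by rewrite /row_free mxrank0.
  by apply: (gen d 0%N 0 v) => // -[].
elim=> [|n ih] k M {va}v kd Mfree va aM.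
  apply: sub_conv_hull; apply/voronoi_vertexP => //; split=> // w vw.
  have Mw := neutral_active_rows aM vw.
  move: kd M Mfree aM Mw; rewrite addn0 => -> M Mfree aM Mw.
  have Mu : M \in unitmx by rewrite -row_free_unit.
  by apply/eqP; rewrite -trmx_eq0 -(mulKmx Mu w^T) Mw mulmx0.
have [v0|/existsNP[w /not_implyP[vw /eqP w0]]] := pselect (forall w, neutral eta a v w -> w = 0).
  by apply: sub_conv_hull; apply/voronoi_vertexP.
have Mw := neutral_active_rows aM vw.
have exit w' : w' != 0 -> neutral eta a v w' -> exists t, 0 < t /\
    conv_hull (vertices (voronoi_cell eta a)) (v + t *: w').
  move=> w'0 vw'; have [t [t0 vt [b [etab vb wb]]]] := voronoi_exit bnd va w'0 vw'.
  have Mw' := neutral_active_rows aM vw'.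
  exists t; split=> //; apply: (ih _ (col_mx (b - a) M)) => //.
  - by rewrite add1n addSnnS.
  - apply: (row_free_extend Mfree Mw').
    by rewrite dotp_mx dotpC -scalemx1 scaler_eq0 negb_or wb oner_eq0.
  - by apply: active_rows_extend => //; exact: active_rows_line.
have [t [t0 vt]] := exit w w0 vw.
have [|b etab vb|s [s0 vs]] := exit (- w); first by rewrite oppr_eq0.
  by rewrite dotpNl (vw b)// oppr0.
have /convexP/(_ _ _ (s / (s + t)) vt vs) := @conv_hull_convex _ _ (vertices (voronoi_cell eta a)).
have st0 : 0 < s + t by rewrite addr_gt0.
rewrite divr_ge0 ?(ltW s0) ?(ltW st0)// ler_pdivrMr// mul1r lerDl (ltW t0).
have -> : s / (s + t) *: (v + t *: w) + (1 - s / (s + t)) *: (v + s *: - w) = v.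
  by apply/rowP => j; rewrite !mxE; field; rewrite gt_eqF.
exact.
Qed.

Lemma conv_hull_vertices eta a r : (0 < d)%N ->
  (forall v, voronoi_cell eta a v -> `|v| <= r) ->
  conv_hull (vertices (voronoi_cell eta a)) = voronoi_cell eta a.
Proof.
move=> d0 bnd; apply/seteqP; split; last exact: voronoi_sub_hull bnd.
apply: conv_hull_sub; first exact: voronoi_cell_convex.
by move=> v [H _ HK]; have [] : (H `&` voronoi_cell eta a) v by rewrite HK.
Qed.

Definition normals a (b : 'I_d -> 'rV[R]_d) : 'M[R]_d := \matrix_(i, j) (b j - a) 0 i.

(** Cramer's rule for the linear system expressing that a point has the same
    distance to a and to each b j. With the adjugate in place of the inverse
    matrix it is visibly a rational function of the data. *)
Definition circumcenter a (b : 'I_d -> 'rV[R]_d) : 'rV[R]_d :=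
  (\det (normals a b))^-1 *:
    ((\row_j ((dotp (b j) (b j) - dotp a a) / 2)) *m \adj (normals a b)).

Lemma mul_normals a (b : 'I_d -> 'rV[R]_d) v j : (v *m normals a b) 0 j = dotp v (b j - a).
Proof. by rewrite mxE; apply: eq_bigr => i _; rewrite mxE. Qed.

Lemma circumcenterP a (b : 'I_d -> 'rV[R]_d) v : \det (normals a b) != 0 ->
  v = circumcenter a b <-> forall j, power_gap a (b j) v = 0.
Proof.
move=> det0; rewrite /circumcenter; set beta := \row_j _.
have eqv : v *m normals a b = beta <-> forall j, power_gap a (b j) v = 0.
  split=> [e j|h].
    have := congr1 (fun M : 'rV_d => M 0 j) e; rewrite mul_normals mxE /power_gap => ->.
    by field.
  apply/rowP => j; rewrite mul_normals mxE; have := h j; rewrite /power_gap => e.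
  by lra.
rewrite -eqv; split=> [->|<-].
  by rewrite -scalemxAl -mulmxA mul_adj_mx mul_mx_scalar scalerA mulVf// scale1r.
by rewrite -mulmxA mul_mx_adj mul_mx_scalar scalerA mulVf// scale1r.
Qed.

(** The active normals at a vertex span, so d of them already form an
    invertible matrix and determine the vertex. *)
Lemma vertex_circumcenterP eta a v : (0 < d)%N ->
  vertices (voronoi_cell eta a) v <-> exists b : 'I_d -> 'rV[R]_d,
    [/\ forall j, points eta (b j), \det (normals a b) != 0,
        circumcenter a b = v & voronoi_cell eta a v].
Proof.
move=> d0; rewrite voronoi_vertexP//; split; last first.
  move=> [b [etab det0 /esym/(circumcenterP v det0) vb va]]; split=> // w vw.
  have : w *m normals a b = 0.
    by apply/rowP => j; rewrite mul_normals mxE vw.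
  have u : normals a b \in unitmx by rewrite unitmxE unitfE.
  by move/(congr1 (mulmx^~ (invmx (normals a b)))); rewrite mulmxK// mul0mx.
move=> [va v0].
have [M Mfree aM] : exists2 M : 'M[R]_d, row_free M & active_rows eta a v M.
  suff gen k : (k <= d)%N -> exists2 M : 'M[R]_(k, d), row_free M & active_rows eta a v M.
    exact: gen.
  elim: k => [|k ih] kd.
    by exists 0; [rewrite /row_free mxrank0|case].
  have [M Mfree aM] := ih (ltnW kd).
  have [w w0 Mw] := exists_orthogonal M kd.
  have [b [etab vb wb]] : exists b, [/\ points eta b, power_gap a b v = 0 & dotp w (b - a) != 0].
    apply: contrapT => nb; move/eqP: w0; apply; apply: v0 => b etab vb.
    by apply/eqP/negPn/negP => wb; apply: nb; exists b.
  exists (col_mx (b - a) M); last exact: active_rows_extend.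
  apply: (row_free_extend Mfree Mw).
  by rewrite dotp_mx dotpC -scalemx1 scaler_eq0 negb_or wb oner_eq0.
have /choice[b bP] := aM.
have normalsE : normals a b = M^T.
  apply/matrixP => i j; rewrite !mxE; have [_ _ /rowP/(_ i)] := bP j.
  by rewrite !mxE => ->.
have det0 : \det (normals a b) != 0.
  by rewrite normalsE det_tr -unitfE -unitmxE -row_free_unit.
exists b; split=> // [j|]; first by case: (bP j).
by apply/esym/circumcenterP => // j; case: (bP j).
Qed.

Lemma finite_vertices eta a r : (0 < d)%N -> (forall v, voronoi_cell eta a v -> `|v| <= r) ->
  finite_set (vertices (voronoi_cell eta a)).
Proof.
move=> d0 bnd; have [r' rb] := gap_bound a r.
have finK := points_lfin eta (cube_bounded r').
pose F := fset_set (points eta `&` cube r').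
apply: (@sub_finite_set _ _
  ((fun f : {ffun 'I_d -> F} => circumcenter a (fun j => val (f j))) @` setT)).
  move=> v /vertex_circumcenterP-/(_ d0)[b [etab det0 vb va]].
  have bF j : b j \in F.
    rewrite in_fset_set// inE; split=> //; apply: rb (bnd _ va) _.
    by have /(circumcenterP v det0)/(_ j) -> := esym vb.
  exists [ffun j => [` bF j]%fset] => //; rewrite -vb; congr circumcenter.
  by apply/funext => j; rewrite ffunE.
exact: finite_image.
Qed.

Lemma voronoi_cover eta x : points eta !=set0 -> exists2 a, points eta a & voronoi_cell eta a x.
Proof.
move=> [a0 etaa0]; have [r rb] := gap_bound a0 `|x|.
pose F := fset_set (points eta `&` cube r).
have finK := points_lfin eta (cube_bounded r).
have a0F : a0 \in F.
  rewrite in_fset_set// inE; split=> //; apply: rb (lexx _) _.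
  by rewrite /power_gap !subrr dotp0r mulr0 subrr.
pose f (b : F) : R := dotp (x - val b) (x - val b).
have [a _ amin] := @Order.TotalTheory.arg_minP _ _ _ [` a0F]%fset xpredT f isT.
have : val a \in F := valP a; rewrite in_fset_set// inE => -[etaa _].
have fE b : (f a <= dotp (x - b) (x - b)) = (power_gap (val a) b x <= 0).
  by rewrite -edist_power_gap /Defs.edist ler_psqrt ?nnegrE ?dotp_ge0.
exists (val a) => //; apply/voronoi_cellE => b etab; rewrite -fE.
have [bF|bF] := boolP (b \in F); first exact: (amin [` bF]%fset).
apply: le_trans (amin [` a0F]%fset isT) _ => /=.
rewrite leNgt; apply/negP => h; move/negP: bF; apply.
rewrite in_fset_set// inE; split=> //; apply: rb (lexx _) _.
rewrite -power_gap_le0 -edist_power_gap /Defs.edist ler_psqrt ?nnegrE ?dotp_ge0//.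
exact: ltW.
Qed.

End voronoi_vertices.

(** * Certificates from real hyperplanes *)

Section certificates_from_reals.
Context {R : realType} {d : nat}.
Implicit Types (X Y : Defs.cluster R d) (u x y : 'rV[R]_d) (c t : R).

Lemma continuous_dotp_fst x : continuous (fun p : 'rV[R]_d * R => dotp p.1 x).
Proof.
move=> p; apply: (@continuous_comp _ _ _ fst (fun u => dotp u x)); first exact: cvg_fst.
exact: continuous_dotp.
Qed.

Lemma near_fset X (p0 : 'rV[R]_d * R) (Q : 'rV[R]_d -> 'rV[R]_d * R -> Prop) :
  (forall x, x \in X -> \forall p \near p0, Q x p) ->
  \forall p \near p0, forall x, x \in X -> Q x p.
Proof. exact: (near_finite (F := nbhs p0) (Q := Q) (finite_fset X)). Qed.

(** Scaling the hyperplane into the unit box is harmless; afterwards all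
    requirements on (w, q) are open conditions that hold at (u, c). *)
Lemma separation_certificateI X Y u c :
  (forall x, x \in X -> dotp u x <= c) -> (forall y, y \in Y -> c <= dotp u y) ->
  (forall x, x \in X -> x \notin Y -> dotp u x < c) ->
  (forall y, y \in Y -> y \notin X -> c < dotp u y) ->
  separation_certificate X Y.
Proof.
wlog [u1 c1] : u c / `|u| < 1 /\ `|c| < 1.
  move=> gen Xc Yc XYc YXc; pose s := (1 + `|u| + `|c|)^-1.
  have s0 : 0 < s by rewrite invr_gt0 ltr_pwDl// ltr_pwDl.
  have un : `|s *: u| < 1.
    by rewrite normrZ gtr0_norm// mulrC ltr_pdivrMr ?invr_gt0// mul1r; have := normr_ge0 c; lra.
  have cn : `|s * c| < 1.
    by rewrite normrM gtr0_norm// mulrC ltr_pdivrMr ?invr_gt0// mul1r; have := normr_ge0 u; lra.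
  apply: (gen (s *: u) (s * c)) => // x *; rewrite dotpZl.
  - by rewrite ler_pM2l// Xc.
  - by rewrite ler_pM2l// Yc.
  - by rewrite ltr_pM2l// XYc.
  - by rewrite ltr_pM2l// YXc.
move=> Xc Yc XYc YXc.
have [e1 e10 e1P] := @finite_lower_bound R _ [set x | x \in X /\ x \notin Y]
  (fun x => c - dotp u x) (sub_finite_set (fun x => @proj1 _ _) (finite_fset X))
  ltac:(by move=> x [xX xY]; rewrite subr_gt0 XYc).
have [e2 e20 e2P] := @finite_lower_bound R _ [set x | x \in Y /\ x \notin X]
  (fun x => dotp u x - c) (sub_finite_set (fun x => @proj1 _ _) (finite_fset Y))
  ltac:(by move=> x [xX xY]; rewrite subr_gt0 YXc).
have e0 : 0 < Num.min e1 e2 by rewrite lt_min e10.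
have [n _ /(_ n (leqnn n))/=] := near_infty_natSinv_lt (PosNum e0).
rewrite /= lt_min => /andP[ne1 ne2].
exists n => m; have m0 : 0 < m.+1%:R^-1 :> R by rewrite invr_gt0.
have h1 : \forall p \near (u, c), `|p.1| < 1.
  have /cvgr_lt/(_ _ u1) : `|p.1| @[p --> (u, c)] --> `|u|.
    by apply: cvg_norm; exact: (@cvg_fst _ _ (nbhs u) (nbhs c)).
  exact.
have h2 : \forall p \near (u, c), `|p.2| < 1.
  have /cvgr_lt/(_ _ c1) : `|p.2| @[p --> (u, c)] --> `|c|.
    by apply: cvg_norm; exact: (@cvg_snd _ _ (nbhs u) (nbhs c)).
  exact.
have cont x := (@continuous_dotp_sub R d x (u, c)).
have h3 : \forall p \near (u, c), forall x, x \in X -> dotp p.1 x - p.2 < m.+1%:R^-1.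
  apply: near_fset => x xX; apply: (cvgr_lt _ (cont x)) => /=.
  by rewrite (le_lt_trans _ m0)// subr_le0 Xc.
have h4 : \forall p \near (u, c), forall x, x \in Y -> - m.+1%:R^-1 < dotp p.1 x - p.2.
  apply: near_fset => x xY; apply: (cvgr_gt _ (cont x)) => /=.
  by rewrite (@lt_le_trans _ _ 0)// ?oppr_lt0// subr_ge0 Yc.
have h5 : \forall p \near (u, c), forall x, x \in X -> x \notin Y ->
    dotp p.1 x - p.2 < - n.+1%:R^-1.
  apply: near_fset => x xX; have [xY|xY] := boolP (x \in Y); first by near=> p.
  have : \forall p \near (u, c), dotp p.1 x - p.2 < - n.+1%:R^-1.
    apply: (cvgr_lt _ (cont x)) => /=.
    have /= := e1P x (conj xX xY); move/(lt_trans ne1).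
    by set z := n.+1%:R^-1; lra.
  by apply: filterS => p.
have h6 : \forall p \near (u, c), forall x, x \in Y -> x \notin X -> n.+1%:R^-1 < dotp p.1 x - p.2.
  apply: near_fset => x xY; have [xX|xX] := boolP (x \in X); first by near=> p.
  have : \forall p \near (u, c), n.+1%:R^-1 < dotp p.1 x - p.2.
    apply: (cvgr_gt _ (cont x)) => /=.
    by have /= := e2P x (conj xY xX); exact: lt_trans.
  by apply: filterS => p.
have [w [q [w1 [q1 [X1 [Y1 [X2 Y2]]]]]]] :=
  nbhs_ratv_pair (filterI h1 (filterI h2 (filterI h3 (filterI h4 (filterI h5 h6))))).
exists w, q; split.
- split=> [i|]; rewrite /= in_itv/= -ler_norml; last exact: ltW.
  by apply: le_trans (ltW w1); exact: normr_coord.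
- move=> [x xX /=]; have := X1 x xX => /=.
  by set M := m.+1%:R^-1; lra.
- move=> [y yY /=]; have := Y1 y yY => /=.
  by set M := m.+1%:R^-1; lra.
- move=> i [x xX [ix /= h]]; have [xY|xY] := boolP (x \in Y); first by exists x.
  by have := X2 x xX xY; move: h => /=; set N := n.+1%:R^-1; lra.
- move=> i [y yY [iy /= h]]; have [yX|yX] := boolP (y \in X); first by exists y.
  by have := Y2 y yY yX; move: h => /=; set N := n.+1%:R^-1; lra.
Unshelve. all: by end_near. Qed.

Lemma exposed_certificateI X : (forall z, z \in X -> exists u,
    u != 0 /\ forall x, x \in X -> x != z -> dotp u x < dotp u z) ->
  exposed_certificate X.
Proof.
move=> Xexp i /card_eq1P[z Xz].
have [zX iz] : ([set` X] `&` rbox i) z by rewrite Xz.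
have [u [u0 uz]] := Xexp z zX.
have [e e0 eP] := @finite_lower_bound R _ [set x | x \in X /\ x != z]
  (fun x => dotp u z - dotp u x) (sub_finite_set (fun x => @proj1 _ _) (finite_fset X))
  ltac:(by move=> x [xX xz]; rewrite subr_gt0 uz).
(* e is less than every gap to another vertex, so this level separates
   strictly *)
pose c := dotp u z - e.
have h1 : \forall p \near (u, c), 0 < dotp p.1 u.
  by apply: (cvgr_gt _ (@continuous_dotp_fst u (u, c))); rewrite dotp_gt0.
have h2 : \forall p \near (u, c), 0 < dotp p.1 z - p.2.
  by apply: (cvgr_gt _ (@continuous_dotp_sub R d z (u, c))); rewrite /= /c subKr.
have h3 : \forall p \near (u, c), forall x, x \in X -> x != z -> dotp p.1 x - p.2 < 0.
  apply: near_fset => x xX; have [->|xz] := eqVneq x z; first by near=> p.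
  have : \forall p \near (u, c), dotp p.1 x - p.2 < 0.
    apply: (cvgr_lt _ (@continuous_dotp_sub R d x (u, c))) => /=.
    by have := eP x (conj xX xz); rewrite /c /=; lra.
  by apply: filterS => p.
have [w [q [wu [wz wx]]]] := nbhs_ratv_pair (filterI h1 (filterI h2 h3)).
exists w, q; split.
- by apply: contraTneq wu => /= ->; rewrite dotp0l ltxx.
- move=> [x xX [ix /=]]; have -> : x = z by have /seteqP[/(_ x) + _] := Xz; apply.
  by move: wz; rewrite /=; lra.
- move=> [x xX [ix /=]]; have xz : x != z by apply: contra_not_neq ix => ->.
  by have := wx x xX xz; rewrite /=; lra.
Unshelve. all: by end_near. Qed.

(** The l1 norm is continuous, so the strict inequalities persist at a
    rational direction. *)
Lemma far_certificateI (N : nat) X u :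
  (forall x, x \in X -> N%:R * l1norm u < dotp u x) ->
  exists w : 'rV[rat]_d,
    ~ hits [set x | dotp (ratv w) x <= N%:R * l1norm (ratv w)] X.
Proof.
move=> uX; have cl1 : continuous (@l1norm R d).
  apply: continuous_big => [|i _ v]; first exact: add_continuous.
  apply: (@continuous_comp _ _ _ (fun v : 'rV[R]_d => v 0 i) Num.norm).
    exact: coord_continuous.
  exact: norm_continuous.
have : \forall v \near u, forall x, [set` X] x -> 0 < dotp v x - N%:R * l1norm v.
  apply: (near_finite (F := nbhs u) (Q := fun x v => 0 < dotp v x - N%:R * l1norm v)).
    exact: finite_fset.
  move=> x /uX ux; have : dotp v x - N%:R * l1norm v @[v --> u] --> dotp u x - N%:R * l1norm u.
    apply: (cvgB (@continuous_dotp R d x u)).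
    by apply: cvgMl_tmp; exact: cl1.
  by move=> /cvgr_gt; apply; rewrite subr_gt0.
move=> /nbhs_ratv[w wX]; exists w => -[x xX /=].
by have := wX x xX; lra.
Qed.

End certificates_from_reals.

(** * The Voronoi tessellation *)

Section voronoi_certified.
Context {R : realType} {d : nat}.
Hypothesis d0 : (0 < d)%N.
Implicit Types (X : Defs.cluster R d) (u v w x y a b : 'rV[R]_d) (c t : R).

Definition vertex_cluster (eta : set 'rV[R]_d) a : Defs.cluster R d :=
  fset_set (vertices (voronoi_cell eta a)).

(** On the bisector of a and b the gaps relative to a and to b agree, so the
    active constraints are the same. A vector orthogonal to the normals taken
    from b is orthogonal to a - b too, hence to the normals taken from a. *)
Lemma vertex_neighbour (eta : point_set R d) a b v : points eta a -> points eta b ->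
  power_gap a b v = 0 -> vertices (voronoi_cell eta a) v ->
  vertices (voronoi_cell eta b) v.
Proof.
move=> etaa etab abv; rewrite !voronoi_vertexP// => -[/voronoi_cellE va v0].
have gapE b' : power_gap b b' v = power_gap a b' v by rewrite (power_gapD a b) abv add0r.
split=> [|w vw]; first by apply/voronoi_cellE => b' etab'; rewrite gapE va.
have wa : dotp w (a - b) = 0 by apply: vw => //; rewrite power_gapC abv oppr0.
apply: v0 => b' etab' b'v.
by rewrite -(subrK b b') -addrA dotpDr vw ?gapE// add0r -opprB dotpNr wa oppr0.
Qed.

Section fixed_configuration.
Variable eta : point_config R d.
Hypothesis hullT : conv_hull (points eta) = setT.

Let bnd a : points eta a -> exists r, forall v, voronoi_cell (points eta) a v -> `|v| <= r.
Proof. exact: voronoi_bounded. Qed.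

Lemma vertex_clusterE a : points eta a ->
  [set` vertex_cluster eta a] = vertices (voronoi_cell (points eta) a).
Proof. by move=> /bnd[r rP]; apply: fset_setK; exact: finite_vertices rP. Qed.

Lemma conv_hull_vertex_cluster a : points eta a ->
  conv_hull [set` vertex_cluster eta a] = voronoi_cell (points eta) a.
Proof.
by move=> etaa; have [r rP] := bnd etaa; rewrite vertex_clusterE//; exact: conv_hull_vertices rP.
Qed.

Lemma psi_clusters X : clusters (psi_DV eta) X <->
  exists2 a, points eta a & vertex_cluster eta a = X.
Proof.
split=> [[_ [a etaa Xa]]|[a etaa <-]].
  by exists a; rewrite // /vertex_cluster -Xa set_fsetK.
by split=> //; exists a => //; exact: vertex_clusterE.
Qed.

Lemma in_vertex_cluster a v : points eta a ->
  (v \in vertex_cluster eta a) = `[< vertices (voronoi_cell (points eta) a) v >].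
Proof.
move=> etaa; apply/idP/asboolP => [va|]; last by rewrite -vertex_clusterE.
by rewrite -vertex_clusterE.
Qed.

Lemma vertex_cluster_cell a v : points eta a -> v \in vertex_cluster eta a ->
  voronoi_cell (points eta) a v.
Proof. by move=> etaa; rewrite in_vertex_cluster// => /asboolP/voronoi_vertexP-/(_ d0)[]. Qed.

Lemma voronoi_exposed a : points eta a -> exposed_certificate (vertex_cluster eta a).
Proof.
move=> etaa; apply: exposed_certificateI => z; rewrite in_vertex_cluster// => /asboolP.
move=> [_ [u [c [u0 -> uc _]]] Hz]; exists u; split=> // x xX xz.
have xa := vertex_cluster_cell etaa xX.
have [uz _] : (hyperplane u c `&` voronoi_cell (points eta) a) z by rewrite Hz.
rewrite uz lt_neqAle uc// andbT; apply: contraNneq xz => uxc; apply/eqP.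
by have : (hyperplane u c `&` voronoi_cell (points eta) a) x by []; rewrite Hz.
Qed.

Lemma points_nonempty : points eta !=set0.
Proof. by apply: (@conv_hull_nonempty R d _ 0); rewrite hullT. Qed.

(** Fix a nucleus b. If a is far enough away, every point of the cube is
    strictly closer to b than to a, so the bisector of a and b separates the
    cube from the cell of a. Only finitely many cells remain, all bounded. *)
Lemma voronoi_far N : exists K, forall a, points eta a ->
  near_or_separated N K (vertex_cluster eta a).
Proof.
have [b etab] := points_nonempty; have [r rb] := gap_bound b N%:R.
pose F := fset_set (points eta `&` cube r).
have finK := points_lfin eta (cube_bounded r).
have /choice[f fP] : forall a, exists s, points eta a ->
    forall v, voronoi_cell (points eta) a v -> `|v| <= s.
  move=> a; have [/bnd[s sP]|na] := pselect (points eta a); first by exists s.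
  by exists 0.
exists (Num.bound (\sum_(a <- F) `|f a|)) => a etaa.
have [ar|ar] := leP `|a| r.
  have aF : a \in F by rewrite in_fset_set// inE.
  have [->|[x xX]] := fset_0Vmem (vertex_cluster eta a).
    by right; exists 0 => -[x]; rewrite inE.
  left; exists x => //; rewrite /cube/=.
  apply: le_trans (fP _ etaa _ (vertex_cluster_cell etaa xX)) _.
  apply: le_trans (ler_norm _) _.
  apply: (@le_trans _ _ (\sum_(a <- F) `|f a|)).
    by rewrite (big_rem a)//= lerDl sumr_ge0.
  by apply: ltW; rewrite archi_boundP// sumr_ge0.
right; apply: (@far_certificateI _ _ _ _ (a - b)) => v /(vertex_cluster_cell etaa).
move=> /voronoi_cellE/(_ b etab) va.
(* a point of the cube that maximizes the linear form of a - b *)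
pose x : 'rV[R]_d := N%:R *: \row_i Num.sg ((a - b) 0 i).
have xN : `|x| <= N%:R.
  rewrite normrZ ger0_norm// ler_piMr//.
  rewrite [leLHS]/Num.norm/= mx_normrE; apply/bigmax_leP; split=> // -[i j] _ /=.
  by rewrite mxE normr_sg; case: (_ == 0).
have xgap : power_gap b a x < 0.
  by rewrite ltNge; apply/negP => /(rb _ _ xN); rewrite leNgt ar.
have xl : dotp (a - b) x = N%:R * l1norm (a - b).
  rewrite dotpZr; congr (_ * _); apply: eq_bigr => i _.
  by rewrite [X in _ * X]mxE normrEsg mulrC.
rewrite -xl; move: xgap va; rewrite /power_gap.
by rewrite !dotpBr !dotpBl !(dotpC v) !(dotpC x); lra.
Qed.

(** The bisector is the separating hyperplane; this includes a = b, where it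
    degenerates to u = 0. *)
Lemma voronoi_separated a b : points eta a -> points eta b ->
  separation_certificate (vertex_cluster eta a) (vertex_cluster eta b).
Proof.
move=> etaa etab; pose u := b - a; pose c := (dotp b b - dotp a a) / 2.
have gapE v : power_gap a b v = 2 * (dotp u v - c).
  by rewrite /power_gap /u /c dotpC; field.
have le_a x : x \in vertex_cluster eta a -> dotp u x <= c.
  move=> /(vertex_cluster_cell etaa)/voronoi_cellE/(_ b etab).
  by rewrite gapE pmulr_rle0// subr_le0.
have ge_b x : x \in vertex_cluster eta b -> c <= dotp u x.
  move=> /(vertex_cluster_cell etab)/voronoi_cellE/(_ a etaa).
  by rewrite power_gapC gapE oppr_le0 pmulr_rge0// subr_ge0.
apply: (@separation_certificateI R d _ _ u c) => // x xX xY.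
- rewrite lt_neqAle le_a// andbT; apply: contraNneq xY => uxc.
  rewrite in_vertex_cluster//; apply/asboolP; apply: (vertex_neighbour etaa etab).
    by rewrite gapE uxc subrr mulr0.
  by move: xX; rewrite in_vertex_cluster// => /asboolP.
- rewrite lt_neqAle ge_b// andbT; apply: contraNneq xY => uxc.
  rewrite in_vertex_cluster//; apply/asboolP; apply: (vertex_neighbour etab etaa).
    by rewrite power_gapC gapE -uxc subrr mulr0 oppr0.
  by move: xX; rewrite in_vertex_cluster// => /asboolP.
Qed.

Lemma certified_psi : certified (psi_DV eta).
Proof.
have clE i : single_cluster i (psi_DV eta) -> clusters (psi_DV eta) (cluster_at i (psi_DV eta)).
  by move=> ipsi; apply/cluster_at_enum; exists i.
split.
- by move=> X /psi_clusters[a etaa <-]; exact: voronoi_exposed.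
- move=> N; have [K KP] := voronoi_far N; exists K => X /psi_clusters[a etaa <-].
  exact: KP.
- move=> i j /clE/psi_clusters[a etaa <-] /clE/psi_clusters[b etab <-].
  exact: voronoi_separated.
- move=> q; have [a etaa qa] := voronoi_cover (ratv q) points_nonempty.
  exists (vertex_cluster eta a); split; first by apply/psi_clusters; exists a.
  by rewrite conv_hull_vertex_cluster.
Qed.

End fixed_configuration.
End voronoi_certified.

(** * Measurability of the Voronoi map *)

Section measurable_matrices.
Context {disp} {T : measurableType disp} {R : realType}.

Lemma measurable_det n (M : T -> 'M[R]_n) :
  (forall i j, measurable_fun setT (fun t => M t i j)) ->
  measurable_fun setT (fun t => \det (M t)).
Proof.
move=> mM; apply: measurable_sum => s; apply: measurable_funM; first exact: measurable_cst.
by apply: measurable_prod => i _; exact: mM.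
Qed.

Lemma measurable_adj n (M : T -> 'M[R]_n) i j :
  (forall i j, measurable_fun setT (fun t => M t i j)) ->
  measurable_fun setT (fun t => \adj (M t) i j).
Proof.
move=> mM; under eq_fun do rewrite mxE.
apply: measurable_funM; first exact: measurable_cst.
by apply: measurable_det => k l; under eq_fun do rewrite !mxE; exact: mM.
Qed.

Lemma mpred_row_eq d (f g : T -> borel_space R d) :
  measurable_fun setT f -> measurable_fun setT g -> mpred (fun t => f t = g t).
Proof.
move=> /measurable_rowP mf /measurable_rowP mg.
suff : mpred (fun t => forall i, f t 0 i <= g t 0 i /\ g t 0 i <= f t 0 i).
  apply: mpred_ext => t; split=> [fg|-> //]; apply/rowP => i.
  by apply/eqP; rewrite eq_le; apply/andP; exact: fg.
by apply: mpred_all => i; apply: mpred_and; apply: mpred_ler; do ?[exact: mf|exact: mg].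
Qed.

End measurable_matrices.

Section psi_measurability.
Context {R : realType} {d : nat}.
Hypothesis d0 : (0 < d)%N.
Local Notation V := (borel_space R d).
Local Notation C := (cluster_space R d).
Local Notation N := (point_config R d).

Lemma measurable_sub_coord disp (T : measurableType disp) (f g : T -> V) i :
  measurable_fun setT f -> measurable_fun setT g ->
  measurable_fun setT (fun t => ((f t : 'rV[R]_d) - g t) 0 i).
Proof.
move=> /measurable_rowP mf /measurable_rowP mg; under eq_fun do rewrite !mxE.
exact: measurable_funB.
Qed.

Lemma measurable_sub disp (T : measurableType disp) (f g : T -> V) :
  measurable_fun setT f -> measurable_fun setT g ->
  measurable_fun setT (fun t => (f t : 'rV[R]_d) - g t : V).
Proof. by move=> mf mg; apply/measurable_rowP => i; exact: measurable_sub_coord. Qed.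

Lemma measurable_normals_det disp (T : measurableType disp) (f : T -> V) (g : 'I_d -> T -> V) :
  measurable_fun setT f -> (forall j, measurable_fun setT (g j)) ->
  measurable_fun setT (fun t => \det (normals (f t) (fun j => g j t))).
Proof.
move=> mf mg; apply: measurable_det => i j; under eq_fun do rewrite mxE.
exact: measurable_sub_coord.
Qed.

Lemma measurable_circumcenter disp (T : measurableType disp) (f : T -> V) (g : 'I_d -> T -> V) :
  measurable_fun setT f -> (forall j, measurable_fun setT (g j)) ->
  measurable_fun setT (fun t => circumcenter (f t) (fun j => g j t) : V).
Proof.
move=> mf mg; apply/measurable_rowP => i; rewrite /circumcenter.
under eq_fun do rewrite mxE mxE.
apply: measurable_funM; first by apply: measurable_invr; exact: measurable_normals_det.
apply: measurable_sum => j; apply: measurable_funM.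
  under eq_fun do rewrite mxE; apply: measurable_funM; last exact: measurable_cst.
  by apply: measurable_funB; exact: measurable_dotp.
apply: measurable_adj => k l; under eq_fun do rewrite mxE.
exact: measurable_sub_coord.
Qed.

Lemma measurable_power_gap disp (T : measurableType disp) (f g h : T -> V) :
  measurable_fun setT f -> measurable_fun setT g -> measurable_fun setT h ->
  measurable_fun setT (fun t => power_gap (f t : 'rV[R]_d) (g t) (h t)).
Proof.
move=> mf mg mh; apply: measurable_funB; last by apply: measurable_funB; exact: measurable_dotp.
apply: measurable_funM; first exact: measurable_cst.
by apply: measurable_dotp => //; exact: measurable_sub.
Qed.

Definition nucleus (i : rbox_index) (eta : N) : Prop :=
  conv_hull (points eta) = setT /\ single_point i eta.

Lemma mpred_nucleus i : mpred (nucleus i).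
Proof. by apply: mpred_and; [exact: mpred_conv_hull_setT|exact: mpred_single_point]. Qed.

(** The vertices are listed by d-tuples of boxes: the nucleus and the d points
    that these boxes single out determine a circumcenter. *)
Lemma mpred_card_vertices i (B : set V) k : measurable B ->
  mpred (fun eta : N => [set v | nucleus i eta /\
    vertices (voronoi_cell (points eta) (point_at i eta)) v] `&` B #= `I_k).
Proof.
pose f (t : {ffun 'I_d -> rbox_index}) (eta : N) : V :=
  circumcenter (point_at i eta) (fun j => point_at (t j) eta).
pose E (t : {ffun 'I_d -> rbox_index}) (eta : N) := nucleus i eta /\
  ((forall j, single_point (t j) eta) /\
   (~ (\det (normals (point_at i eta) (fun j => point_at (t j) eta)) <= 0 /\
       0 <= \det (normals (point_at i eta) (fun j => point_at (t j) eta))) /\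
    forall l, single_point l eta ->
      power_gap (point_at i eta : 'rV_d) (point_at l eta) (f t eta) <= 0)).
have mf t : measurable_fun setT (f t).
  by apply: measurable_circumcenter => *; exact: measurable_point_at.
have mE t : mpred (E t).
  apply: mpred_and; first exact: mpred_nucleus.
  apply: mpred_and; first by apply: mpred_all => j; exact: mpred_single_point.
  apply: mpred_and.
    have mdet := measurable_normals_det (@measurable_point_at R d i)
      (fun j => @measurable_point_at R d (t j)).
    apply: mpred_not; apply: mpred_and; apply: mpred_ler => //; exact: measurable_cst.
  apply: mpred_all => l; apply: mpred_imp; first exact: mpred_single_point.
  apply: mpred_ler; last exact: measurable_cst.
  by apply: measurable_power_gap => //; exact: measurable_point_at.
move=> mB; apply: (mpred_card (E := E) (f := f)) => //.
- move=> eta v; split=> [[[hullT ipt] /vertex_circumcenterP-/(_ d0)[b [etab det0 bv va]]]|].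
    have /choice[t tP] : forall j, exists l, single_point l eta /\ point_at l eta = b j.
      by move=> j; apply/point_at_enum.
    have bE : (fun j => point_at ([ffun j => t j] j) eta) = b.
      by apply/funext => j; rewrite ffunE (tP j).2.
    exists [ffun j => t j]; rewrite /E /f bE; split=> //; split=> //; split.
      by move=> j; rewrite ffunE; have [] := tP j.
    split.
      by move/andP; rewrite -eq_le; exact/negP.
    by move=> l lpt; move/voronoi_cellE : va; rewrite bv; apply; exact: point_at_mem.
  move=> [t [[nuc [tpt [/andP]]]]]; rewrite -eq_le => det0 cell <-.
  split=> //; apply/vertex_circumcenterP => //; exists (fun j => point_at (t j) eta).
  split=> //; first by move=> j; exact: point_at_mem.
  by apply/voronoi_cellE => b /point_at_enum[l [lpt <-]]; exact: cell.
- move=> t A mA; apply: mpred_and => //.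
  exact: mpred_comp (mf t) mA.
- move=> s t; apply: mpred_and; first exact: mpred_and.
  exact: mpred_row_eq.
Qed.

Lemma mpred_vertex_cluster i (A : set C) : measurable A ->
  mpred (fun eta : N => nucleus i eta /\ A (vertex_cluster (points eta) (point_at i eta))).
Proof.
apply: measurable_of_gen; first exact: mpred_nucleus.
move=> _ [B [_ mB] [k ->]].
have := mpred_and (mpred_nucleus i) (mpred_card_vertices i k mB).
apply: mpred_ext => eta.
have vE : nucleus i eta -> [set` vertex_cluster (points eta) (point_at i eta)] =
    [set v | nucleus i eta /\ vertices (voronoi_cell (points eta) (point_at i eta)) v].
  move=> nuc; case: (nuc) => hullT /point_at_mem etaa; rewrite (vertex_clusterE d0 hullT etaa).
  by apply/seteqP; split=> v //= [].
split=> -[nuc h]; split=> //; first by move: h; rewrite -vE.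
by rewrite -vE.
Qed.

(** Two clusters differ exactly when some box meets one of them only, which
    makes equality of the listed clusters measurable. *)
Lemma measurable_psi : measurable_fun setT (@psi_DV R d).
Proof.
apply: (@measurability _ _ N (cluster_config R d) setT _
  (counting_events (@clusters R d) (@cluster_measurable R d)) erefl).
move=> _ [_ [A mA [k ->]] <-]; rewrite setTI.
change (mpred (fun eta : N => clusters (psi_DV eta) `&` A #= `I_k)).
pose f i (eta : N) : C := vertex_cluster (points eta) (point_at i eta).
apply: (mpred_card (T := C) (E := nucleus) (f := f)) => //.
- move=> eta X; split.
    move=> /[dup] -[hullT _] /(psi_clusters d0 hullT)[a /point_at_enum[i [ipt <-]] <-].
    by exists i.
  move=> [i [[hullT ipt] <-]]; apply/(psi_clusters d0 hullT).
  by exists (point_at i eta) => //; exact: point_at_mem.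
- by move=> i B mB; exact: mpred_vertex_cluster.
- move=> i j.
  have mh i' l : mpred (fun eta => nucleus i' eta /\ hits (rbox l) (f i' eta)).
    by apply: (@mpred_vertex_cluster i' (hits (rbox l))); apply: mpred_hits; exact: rbox_borel.
  have := mpred_and (mpred_and (mpred_nucleus i) (mpred_nucleus j))
    (mpred_all (fun l => mpred_iff (mh i l) (mh j l))).
  apply: mpred_ext => eta; split=> -[nuc]; have [nuci nucj] := nuc; last first.
    move=> fij; split=> [|l]; first exact: nuc.
    by rewrite fij; split=> -[_ hl]; split; [exact: nucj|exact: hl|exact: nuci|exact: hl].
  move=> h; split; first exact: nuc.
  apply/fsetP => v; apply/idP/idP => [vi|vj]; apply: contraT => /missing_box[l [lv]]; case.
    by have [|_] := (h l).1; first by split; [exact: nuci|exists v].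
  by have [|_] := (h l).2; first by split; [exact: nucj|exists v].
Qed.

End psi_measurability.

(** * Volumes of boxes *)

Section poisson.
Context {R : realType}.

Lemma volume0 d : volume (set0 : set 'rV[R]_d) = 0%E.
Proof.
elim: d => [|d ih]; first by rewrite /volume indicE in_set0.
apply: (@integral0_eq _ (measurableTypeR R)) => x _.
by rewrite -[RHS]ih; congr volume; apply/seteqP; split.
Qed.

(** Slicing along the first coordinate gives a function that is constant on
    the first side and zero elsewhere. *)
Lemma volume_box d (I : 'I_d -> set R) (m : R) :
  (forall i, measurable (I i)) -> (forall i, lebesgue_measure (I i) = m%:E) ->
  volume [set v : 'rV[R]_d | forall i, I i (v 0 i)] = (m ^+ d)%:E.
Proof.
elim: d I => [|d ih] I mI lI.
  by rewrite /volume indicE mem_set// => -[].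
rewrite [LHS]/volume -/volume.
have -> : (fun x => volume [set v : 'rV[R]_d |
      [set v : 'rV[R]_d.+1 | forall i, I i (v 0 i)] (row_mx (x%:M : 'rV[R]_1) v)]) =
    (cst (m ^+ d)%:E) \_ (I ord0).
  apply/funext => x; rewrite patchE.
  have boxE v : (forall i, I i ((row_mx (x%:M : 'rV[R]_1) v : 'rV[R]_d.+1) 0 i)) <->
      I ord0 x /\ forall i, I (lift ord0 i) (v 0 i).
    have e0 : (row_mx (x%:M : 'rV[R]_1) v : 'rV[R]_d.+1) 0 ord0 = x.
      have -> : ord0 = lshift d (ord0 : 'I_1) by apply/val_inj.
      by apply: etrans (row_mxEl _ _ _ _) _; rewrite mxE eqxx mulr1n.
    have el i : (row_mx (x%:M : 'rV[R]_1) v : 'rV[R]_d.+1) 0 (lift ord0 i) = v 0 i.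
      have -> : lift ord0 i = rshift 1 i by apply/val_inj.
      exact: row_mxEr.
    split=> [h|[h0 hl] i]; first by split=> [|i]; [rewrite -e0|rewrite -el].
    by have [j ->|->] := unliftP ord0 i; rewrite ?el ?e0.
  case: ifPn => [/set_mem Ix|/negP Ix].
    rewrite -(ih (fun i => I (lift ord0 i))) //.
    by congr volume; apply/seteqP; split=> v; [move/boxE => []|move=> h; apply/boxE].
  rewrite [X in volume X](_ : _ = set0) ?volume0//.
  by apply/seteqP; split=> v // /boxE[/mem_set].
rewrite -integral_mkcond integral_cst//; last exact: mI.
by rewrite exprSr EFinM; congr (_ * _)%E; exact: lI.
Qed.

End poisson.

(** * Void probabilities *)

Section orthants.
Context {R : realType} {d : nat}.
Implicit Types (s : {ffun 'I_d -> bool}) (N : nat).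

Definition orthant_side s N (m : R) (i : 'I_d) : set R :=
  [set x | N%:R < (-1) ^+ s i * x < N%:R + m].

Definition orthant_box s N m : set 'rV[R]_d :=
  [set v | forall i, orthant_side s N m i (v 0 i)].

Definition misses_orthant s N (eta : point_config R d) :=
  forall b, points eta b -> ~ forall i, N%:R < (-1) ^+ s i * b 0 i.

Lemma orthant_sideE s N m i :
  orthant_side s N m i =
  if s i then `](- (N%:R + m)), (- N%:R)[%classic else `]N%:R, (N%:R + m)[%classic.
Proof.
apply/seteqP; split=> x; rewrite /orthant_side/=; case: (s i);
  rewrite /= ?in_itv/= ?expr0 ?expr1 ?mul1r ?mulN1r//.
  by rewrite ltrNr andbC ltrNl.
by rewrite ltrNr andbC ltrNl.
Qed.

Lemma volume_orthant_box s N m : 0 <= m -> volume (orthant_box s N m) = (m ^+ d)%:E.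
Proof.
move=> m0; apply: volume_box => i; rewrite orthant_sideE; case: (s i) => //;
  rewrite lebesgue_measure_itv/= lte_fin.
- rewrite ltrN2 ltrDl lt_neqAle m0 andbT; case: eqVneq => [<-//|_] /=.
  by rewrite -EFinB opprK addrC addrAC subrr add0r.
- rewrite ltrDl lt_neqAle m0 andbT; case: eqVneq => [<-//|_] /=.
  by rewrite -EFinB addrAC subrr add0r.
Qed.

Lemma bounded_borel_orthant_box s N m : bounded_borel (orthant_box s N m).
Proof.
split.
  apply: (@sub_bounded_set _ _ _ (cube (N%:R + `|m|))); last exact: cube_bounded.
  move=> v vi; rewrite /cube/=; rewrite [leLHS]/Num.norm/= mx_normrE.
  apply/bigmax_leP; split=> [|[k i] _ /=]; first by rewrite addr_ge0.
  rewrite ord1; have /andP[h1 h2] := vi i.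
  have -> : `|v 0 i| = `|(-1) ^+ s i * v 0 i| by rewrite normrM normr_sign mul1r.
  rewrite ger0_norm; last by rewrite (le_trans _ (ltW h1)).
  by rewrite (le_trans (ltW h2))// lerD2l ler_norm.
have mc i : measurable_fun setT (fun v : borel_space R d => (-1) ^+ s i * v 0 i).
  apply: measurable_funM; first exact: measurable_cst.
  by apply: continuous_borel => x; exact: coord_continuous.
suff : mpred (fun v : borel_space R d => forall i,
    N%:R < (-1) ^+ s i * v 0 i /\ (-1) ^+ s i * v 0 i < N%:R + m).
  by congr measurable; apply/seteqP; split=> v /= h i; have := h i; move=> /andP.
apply: mpred_all => i; apply: mpred_and; apply: mpred_ltr; do ?[exact: mc|exact: measurable_cst].
Qed.

Lemma mpred_misses_orthant s N : mpred (misses_orthant s N).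
Proof.
suff : mpred (fun eta : point_config R d =>
    forall m : nat, points eta `&` orthant_box s N m%:R #= `I_0).
  apply: mpred_ext => eta; split=> [h b etab bN|h m]; last first.
    rewrite card_eq0P; apply/seteqP; split=> // b [etab bm].
    by apply: (h b etab) => i; have /andP[] := bm i.
  have [m bm] := in_cube b; have := h m.+1; rewrite card_eq0P => /seteqP[/(_ b) + _].
  apply; split=> // i; rewrite /orthant_side/= bN/=.
  rewrite (le_lt_trans (ler_norm _))// normrM normr_sign mul1r.
  rewrite (le_lt_trans (normr_coord _ _))// (le_lt_trans bm)//.
  by rewrite -natrD ltr_nat addnS ltnS leq_addl.
apply: mpred_all => m; apply: sub_sigma_algebra.
exists (orthant_box s N m%:R); first exact: bounded_borel_orthant_box.
by exists 0%N.
Qed.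

(** The configuration meets all orthants around x beyond any distance, in
    particular beyond the norm of x. *)
Lemma hull_of_orthants (eta : point_config R d) :
  (forall s N, ~ misses_orthant s N eta) -> conv_hull (points eta) = setT.
Proof.
move=> h; apply/seteqP; split=> // x _; apply: conv_hull_orthants => s.
have [N xN] := in_cube x.
have /existsNP[b /not_implyP[etab /contrapT bN]] := h s N; exists b; split=> // i.
rewrite mulrBr subr_ge0; apply: le_trans (ltW (bN i)).
rewrite (le_trans (ler_norm _))// normrM normr_sign mul1r.
exact: le_trans (normr_coord _ _) xN.
Qed.

End orthants.

Section poisson_void.
Context {R : realType} {d : nat} (lambda : R) (P : probability (point_config R d) R).
Hypothesis d0 : (0 < d)%N.
Hypothesis lambda0 : 0 < lambda.
Hypothesis PP : is_poisson_process (fun B => (lambda%:E * volume B)%E) P.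

(** For a positive integer m, the void probability of a box of side m is exp
    (- lambda m ^ d), which is at most 1 / (1 + lambda m) since d is positive.
    *)
Lemma prob_misses_orthant s N : P [set eta | misses_orthant s N eta] = 0%E.
Proof.
have bound (m : nat) : (P [set eta | misses_orthant s N eta] <=
    (((1 + lambda * m.+1%:R)^-1)%:E))%E.
  have lm : 0 <= lambda * m.+1%:R by rewrite mulr_ge0// ltW.
  have /(_ 1%N (fun=> orthant_box s N m.+1%:R) (fun=> 0%N)) := PP.
  rewrite big_ord_recl big_ord0 mulr1 volume_orthant_box// => PE.
  apply: (@le_trans _ _ (P [set eta |
      forall i : 'I_1, points eta `&` orthant_box s N m.+1%:R #= `I_0])).
    apply: le_measure; rewrite ?inE; first exact: mpred_misses_orthant.
      apply: (@mpred_all _ (point_config R d)) => i; apply: sub_sigma_algebra.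
      exists (orthant_box s N m.+1%:R); first exact: bounded_borel_orthant_box.
      by exists 0%N.
    move=> eta h i; rewrite card_eq0P; apply/seteqP; split=> // b [etab bm].
    by apply: (h b etab) => j; have /andP[] := bm j.
  rewrite PE; last 2 first.
  - by move=> _; exact: bounded_borel_orthant_box.
  - by move=> i j _ _ _; rewrite !ord1.
  rewrite lee_fin /poisson_weight/= expr0 mulr1 fact0 divr1 expRN.
  rewrite lef_pV2 ?posrE ?expR_gt0//; last by rewrite ltr_pwDl.
  apply: le_trans (expR_ge1Dx _); rewrite lerD2l ler_pM2l//.
  by rewrite -{1}(expr1 m.+1%:R) ler_weXn2l// ler1n.
apply/eqP; rewrite eq_le measure_ge0 andbT.
apply/lee_addgt0Pr => e e0; rewrite add0e.
have le0 : 0 < lambda * e by rewrite mulr_gt0.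
have [m _ /(_ m (leqnn m))/= mle] := near_infty_natSinv_lt (PosNum le0).
apply: (le_trans (bound m)); rewrite lee_fin.
rewrite -[e]invrK lef_pV2 ?posrE ?invr_gt0//; last by rewrite ltr_pwDl// mulr_ge0// ltW.
move: mle; rewrite -[ltRHS]invrK ltf_pV2 ?posrE ?invr_gt0// invfM => mle.
have : lambda * (lambda^-1 * e^-1) <= lambda * m.+1%:R by rewrite ler_pM2l// ltW.
by rewrite mulrA divff ?gt_eqF// mul1r => h; rewrite (le_trans h)// lerDr.
Qed.

Lemma poisson_hull_ae : P.-negligible [set eta | conv_hull (points eta) <> setT].
Proof.
pose F k : set (point_config R d) :=
  if (choice.unpickle k : option ({ffun 'I_d -> bool} * nat)) is Some sN
  then [set eta | misses_orthant sN.1 sN.2 eta] else set0.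
have : P.-negligible (\bigcup_k F k).
  apply: negligible_bigcup => k; rewrite /F; case: choice.unpickle => [[s N]|];
    last exact: negligible_set0.
  exists [set eta | misses_orthant s N eta]; split=> //; first exact: mpred_misses_orthant.
  exact: prob_misses_orthant.
apply: negligibleS => eta /= hull; apply: contrapT => nF; apply: hull.
apply: hull_of_orthants => s N h; apply: nF; exists (choice.pickle (s, N)) => //.
by rewrite /F choice.pickleK.
Qed.

End poisson_void.

Theorem proposition3 (R : realType) (d : nat) (lambda : R)
    (P : probability (point_config R d) R) :
  (1 <= d)%N -> 0 < lambda ->
  is_poisson_process (fun B => (lambda%:E * volume B)%E) P ->
  exists2 psi : {mfun point_config R d >-> cluster_config R d},
    psi =1 @psi_DV R d &
    complete_random_cluster_tessellation (distribution P psi).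
Proof.
move=> d0 lambda0 PP.
have mpsi := @measurable_psi R d d0.
exists (mfun_Sub (mem_set mpsi)); first by [].
set Q := distribution P _.
have bad : Q.-negligible [set mu | ~ certified mu].
  exists [set mu | ~ certified mu]; split=> //.
    exact: mpred_not mpred_certified.
  have [A [mA PA hullA]] := poisson_hull_ae d0 lambda0 PP.
  suff : (P (@psi_DV R d @^-1` [set mu | ~ certified mu]) <= P A)%E.
    by rewrite PA => h; apply/eqP; rewrite eq_le measure_ge0 andbT.
  apply: le_measure; rewrite ?inE//.
    by rewrite -[X in measurable X]setTI; apply: (mpsi) => //; exact: mpred_not mpred_certified.
  move=> eta /= ncert; apply: hullA => /= hull; apply: ncert; exact: certified_psi.
split; apply: negligibleS bad => mu /=; apply: contra_not => /certified_tessellation[] //.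
Qed.
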